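(* Let $E\subset\mathbb{R}^n$ be a fixed set and let $m\geq 2$. Let $\mathbf{A}\in\mathbb{R}^{m\times n}$ be a random matrix whose rows $\mathbf{a}_1,\dots,\mathbf{a}_m$ are independent copies of a random vector $\mathbf{a}\in\mathbb{R}^n$. Let $\mathbf{B}\in\mathbb{R}^{\lfloor m/2\rfloor\times n}$ be the matrix with rows $\mathbf{b}_i=(\mathbf{a}_{2i-1}-\mathbf{a}_{2i})/\sqrt{2}$, $i=1,\dots,\lfloor m/2\rfloor$, and let $\mathbf{b}$ denote a random vector with the same distribution as $\mathbf{b}_1$. Let $\{\epsilon_k\}_{k=1}^{\lfloor m/2\rfloor}$ be a Rademacher sequence independent of everything else and set $\mathbf{h}=\frac{1}{\sqrt{\lfloor m/2\rfloor}}\sum_{k=1}^{\lfloor m/2\rfloor}\epsilon_k\mathbf{b}_k$. For $\xi>0$ define $$Q_{\xi}(E,\mathbf{b})=\inf_{\mathbf{u}\in E}\mathbb{P}\big(|\langle\mathbf{b},\mathbf{u}\rangle|\geq\xi\big),\qquad W_{\lfloor m/2\rfloor}(E,\mathbf{b})=\mathbb{E}\Big[\sup_{\mathbf{u}\in E}\langle\mathbf{h},\mathbf{u}\rangle\Big].$$ Then for every $t>0$ and $\xi>0$, with probability at least $1-e^{-2t^2}$, $$\inf_{\mathbf{v}\in E}\|\mathbf{A}\mathbf{v}\|_2\geq \xi\sqrt{\tfrac{m-1}{2}}\,Q_{2\xi}(E,\mathbf{b})-\xi t-2W_{\lfloor m/2\rfloor}(E,\mathbf{b}).$$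
   Context: A Rademacher variable takes the values $1$ and $-1$ with probability $1/2$ each; a Rademacher sequence is a sequence of independent Rademacher variables. *)

(* Defs.v *)
From HB Require Import structures.
From mathcomp Require Import all_boot all_order all_algebra.
From mathcomp Require Import all_classical all_reals all_analysis.
From mathcomp Require Import measurable_realfun.
Set Implicit Arguments. Unset Strict Implicit. Unset Printing Implicit Defensive.
Import Order.TTheory GRing.Theory Num.Theory.
Local Open Scope classical_set_scope.
Local Open Scope ring_scope.

Section Defs.
Context {R : realType}.

Definition dotr n (x u : 'rV[R]_n) : R := \sum_(j < n) x 0 j * u 0 j.

(* The row vector viewed as an n-tuple, so as to use the product
   (Borel) sigma-algebra of n.-tuple R. *)
Definition rv2tuple n (v : 'rV[R]_n) : n.-tuple R := [tuple v 0 j | j < n].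

Definition normAv m n (a : nat -> 'rV[R]_n) (v : 'rV[R]_n) : R :=
  Num.sqrt (\sum_(i < m) (dotr (a i) v) ^+ 2).

(* b_i = (a_(2i-1) - a_(2i)) / sqrt 2, 0-based: b i = (a (2i) - a (2i+1)) / sqrt 2 *)
Definition bvec n (a : nat -> 'rV[R]_n) (i : nat) : 'rV[R]_n :=
  (Num.sqrt 2)^-1 *: (a (2 * i)%N - a (2 * i).+1).

Definition hvec n (k : nat) (eps : nat -> R) (a : nat -> 'rV[R]_n) : 'rV[R]_n :=
  (Num.sqrt k%:R)^-1 *: \sum_(i < k) (eps i *: bvec a i).

Context {d : measure_display} {T : measurableType d}.

Definition sigma_of {d' : measure_display} {V : measurableType d'} (X : T -> V)
  : set_system T := preimage_set_system [set: T] X measurable.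

Definition indep_family (P : probability T R) (I : finType)
  (F : I -> set_system T) : Prop :=
  forall (J : {set I}) (A : I -> set T),
    (forall j, j \in J -> F j (A j)) ->
    P [set w | forall j, j \in J -> A j w] = (\prod_(j in J) P (A j))%E.

Definition same_law (P : probability T R) {d' : measure_display}
  {V : measurableType d'} (X Y : T -> V) : Prop :=
  forall B : set V, measurable B -> P (X @^-1` B) = P (Y @^-1` B).

Definition rademacher (P : probability T R) (e : T -> R) : Prop :=
  measurable_fun [set: T] e /\
  P [set w | e w = 1] = (2^-1)%:E /\ P [set w | e w = -1] = (2^-1)%:E.

Definition Qxi (P : probability T R) n (E : set 'rV[R]_n)
  (b : T -> 'rV[R]_n) (xi : R) : \bar R :=
  ereal_inf [set P [set w | xi <= `|dotr (b w) u|] | u in E].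

Definition supE n (E : set 'rV[R]_n) (h : 'rV[R]_n) : \bar R :=
  ereal_sup [set (dotr h u)%:E | u in E].

Definition Wk (P : probability T R) n (E : set 'rV[R]_n) (h : T -> 'rV[R]_n)
  : \bar R := (\int[P]_w supE E (h w))%E.

End Defs.

(* Main.v *)
Require Import Defs.
From HB Require Import structures.
From mathcomp Require Import all_boot all_order all_algebra.
From mathcomp Require Import all_classical all_reals all_analysis.
From mathcomp Require Import measurable_realfun.
From mathcomp Require Import ring lra zify.
Import Order.TTheory GRing.Theory Num.Theory.
Local Open Scope classical_set_scope.
Local Open Scope ring_scope.

(** Since (x - y)^2 / 2 <= x^2 + y^2, with k = floor(m/2) the norm of A v is at
    least xi / sqrt k times the number of blocks i with |<b_i, v>| >= xi.  For
    finitely many vectors u, the supremum over u of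
    sum_i (P(|<b, u>| >= 2 xi) - 1(|<b_i, u>| >= xi)) is bounded through its
    exponential moments, integrating out one block at a time: Hoeffding's lemma
    costs a factor exp (l^2 / 8), and the mean over that block is at most the mean
    of the supremum in which the summand is replaced by (2 / xi) eps_i <b_i, u>.
    The latter combines symmetrization and contraction, and rests on
    1(|x| >= 2 xi) - 1(|y| >= xi) <= |x - y| / xi.  Each b_i enters the left-hand
    side only through the position of the <b_i, u> relative to 0, xi and 2 xi, so
    it may be replaced by its conditional mean given this finite information, and
    all the integrals of the induction become finite sums; Jensen's inequality
    compares the result with W.  A countable dense subset of E and continuity of
    v |-> |A v| then give the infimum over E. *)

Set Implicit Arguments.
Unset Strict Implicit.
Unset Printing Implicit Defensive.

(** * Hoeffding's lemma *)

Section Hoeffding.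
Context {R : realType}.
Implicit Types l t : R.

Lemma le_of_derive_ge0 (f f' : R -> R) (x : R) : 0 <= x ->
  (forall y, is_derive y (1 : R) f (f' y)) -> (forall y, 0 <= y -> 0 <= f' y) ->
  f 0 <= f x.
Proof.
rewrite le_eqVlt => /predU1P[<-//|x0] df f'0.
have [|c /[!in_itv]/= /andP[c0 _] fE] := @MVT R f f' 0 x x0 (fun y _ => df y).
  by apply: derivable_within_continuous => y _; exact: ex_derive.
by rewrite -subr_ge0 fE mulr_ge0 ?f'0 ?subr0// ltW.
Qed.

(** The function [f], exponent on the right minus the logarithm of the left side, satisfies
    [f 0 = 0] and [f' 0 = 0]. Its second derivative is [1/4] minus the variance of a tilted
    Bernoulli variable, hence nonnegative, and [le_of_derive_ge0] is applied twice. *)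
Lemma bernoulli_mgf_le l t : 0 <= l -> 0 <= t <= 1 ->
  1 - t + t * expR l <= expR (l * t + l ^+ 2 / 8).
Proof.
move=> l0 /andP[t0 t1].
pose D (y : R) : R := 1 - t + t * expR y.
have D0 y : 0 < D y.
  rewrite /D; have := expR_gt0 y; have [->|tn0] := eqVneq t 0; first by lra.
  by have : 0 < t; [rewrite lt_neqAle eq_sym tn0|nra].
have dD y : is_derive y (1 : R) D (t * expR y).
  by apply: is_derive_eq; rewrite /GRing.scale/=; ring.
have dlnD y : is_derive y (1 : R) (@ln R \o D) (t * expR y / D y).
  have ? := is_derive1_ln (D0 y).
  by rewrite mulrC; apply: is_derive1_comp.
pose f (y : R) : R := y * t + y ^+ 2 / 8 - ln (D y).
pose f1 (y : R) : R := t + y / 4 - t * expR y / D y.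
pose f2 (y : R) : R := 4^-1 - t * expR y * (1 - t) / D y ^+ 2.
have df y : is_derive y (1 : R) f (f1 y).
  have -> : f = (fun y => y * t + y ^+ 2 / 8) \- (@ln R \o D) by [].
  apply: is_derive_eq; rewrite /f1 /GRing.scale/=; field.
  by rewrite gt_eqF.
have df1 y : is_derive y (1 : R) f1 (f2 y).
  have Dn0 : D y != 0 by rewrite gt_eqF.
  have dV : is_derive y (1 : R) (fun y => (D y)^-1) (- (D y) ^- 2 * (t * expR y)).
    by apply: is_derive_eq; rewrite /GRing.scale.
  apply: is_derive_eq; rewrite /f2 /GRing.scale/=.
  have -> : D y ^- 2 = (D y)^-1 ^+ 2 by rewrite exprVn.
  have -> : t * expR y = D y - (1 - t) by rewrite /D; ring.
  by field.
have f2_ge0 y : 0 <= f2 y.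
  rewrite /f2 subr_ge0 ler_pdivrMr ?exprn_gt0//.
  rewrite /D; set e := expR y.
  (* This square is the gap in [4 * (1 - t) * (t * e) <= (1 - t + t * e) ^+ 2]. *)
  by have := sqr_ge0 (1 - t - t * e); nra.
have f1_ge0 y : 0 <= y -> 0 <= f1 y.
  move=> y0; apply: le_trans (le_of_derive_ge0 y0 df1 (fun y _ => f2_ge0 y)).
  by rewrite /f1 /D expR0 mulr1 subrK mul0r addr0 divr1 subrr.
have := le_of_derive_ge0 l0 df f1_ge0.
rewrite /f {1}/D expR0 mulr1 subrK ln1 mul0r expr0n/= mul0r addr0 subrr.
by rewrite subr_ge0 -ler_expR lnK// posrE.
Qed.

Lemma expR_chord_le l t : 0 <= t <= 1 -> expR (l * t) <= 1 - t + t * expR l.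
Proof.
move=> t01; have := @convex_expR R (@Itv01 R t (andP t01).1 (andP t01).2) l 0.
rewrite !convRE/= expR0 mulr0 addr0 mulr1 [l * t]mulrC => H.
by apply: (le_trans H); rewrite addrC.
Qed.

(** By convexity the exponential lies below its chord over an interval of length one. Averaging the
    chord gives the moment generating function of a Bernoulli variable with parameter [EY - a], to
    which [bernoulli_mgf_le] applies. *)
Lemma hoeffding_finite (S : finType) (p Y : S -> R) (l a : R) : 0 <= l ->
  (forall c, 0 <= p c) -> \sum_c p c = 1 -> (forall c, a <= Y c <= a + 1) ->
  \sum_c p c * expR (l * Y c)
    <= expR (l ^+ 2 / 8) * expR (l * \sum_c p c * Y c).
Proof.
move=> l0 p0 p1 Ya.
set EY := \sum_c p c * Y c.
have EYa : 0 <= EY - a <= 1.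
  have -> : EY - a = \sum_c p c * (Y c - a).
    under [RHS]eq_bigr do rewrite mulrBr.
    by rewrite sumrB -mulr_suml p1 mul1r.
  rewrite sumr_ge0 => [|c _]; last by have := Ya c; have := p0 c; nra.
  by rewrite -p1; apply: ler_sum => c _; have := Ya c; have := p0 c; nra.
apply: (@le_trans _ _ (expR (l * a) * (1 - (EY - a) + (EY - a) * expR l))).
  have -> : 1 - (EY - a) + (EY - a) * expR l =
      \sum_c p c * (1 - (Y c - a) + (Y c - a) * expR l).
    rewrite (eq_bigr (fun c => p c * (1 + a - a * expR l) + p c * Y c * (expR l - 1))); last by move=> c _; ring.
    by rewrite big_split/= -!mulr_suml p1 -/EY; ring.
  rewrite mulr_sumr; apply: ler_sum => c _.
  have -> : l * Y c = l * a + l * (Y c - a) by ring.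
  rewrite expRD mulrCA; apply: ler_wpM2l; first exact: expR_ge0.
  apply: ler_wpM2l => //.
  by apply: expR_chord_le; have := Ya c; lra.
have H := bernoulli_mgf_le l0 EYa.
have -> : l * EY = l * a + l * (EY - a) by ring.
rewrite expRD [in leRHS]mulrCA.
by apply: ler_wpM2l; [exact: expR_ge0|rewrite [leRHS]mulrC -expRD].
Qed.

End Hoeffding.

(** * Symmetrization for finitely supported summands *)

Section FiniteMax.
Context {R : realType} {N : nat}.
Local Notation V := ('I_N.+1 -> R).
Implicit Types g h x : V.

(** The index type is nonempty, so the default [g ord0] is itself one of the values and leaves the
    maximum unchanged. *)
Definition maxf g : R := \big[Num.max/g ord0]_i g i.

Lemma le_maxf g i : g i <= maxf g.
Proof. exact: le_bigmax. Qed.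

Lemma maxf_ub g c : (forall i, g i <= c) -> maxf g <= c.
Proof. by move=> gc; apply: bigmax_le => // i _; exact: gc. Qed.

Lemma maxf_attained g : exists i, maxf g = g i.
Proof.
rewrite /maxf; elim/big_ind : _ => [|x y [i ->] [j ->]|i _]; [by exists ord0| |by exists i].
by rewrite maxEle; case: ifP; [exists j|exists i].
Qed.

(* The properties of the maximum which survive averaging over shifts of its
   argument; [rf_contract] plays the role of the contraction principle. *)
Record regular_functional (S : finType) (p : S -> R) (G : V -> R) : Prop :=
  RegularFunctional {
  rf_mono : forall g h, (forall u, g u <= h u) -> G g <= G h ;
  rf_addc : forall g c, G (fun u => g u + c) = G g + c ;
  rf_jensen : forall h : S -> V,
    G (fun u => \sum_c p c * h c u) <= \sum_c p c * G (h c) ;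
  rf_contract : forall g h h' x x',
    (forall u v, h u + h' v <= `|x u - x v| + `|x' u - x' v|) ->
    G (fun u => g u + h u) + G (fun u => g u + h' u) <=
    2^-1 * (G (fun u => g u + 2 * x u) + G (fun u => g u - 2 * x u)
          + (G (fun u => g u + 2 * x' u) + G (fun u => g u - 2 * x' u))) }.

(** Expectation over one block: its cell [c] has weight [p c] and shifts the argument by [y c].
    Iterates of [step] integrate out independent blocks one by one. *)
Definition step (S : finType) (p : S -> R) (y : S -> V) (G : V -> R) (g : V) : R :=
  \sum_c p c * G (fun u => g u + y c u).

(** For the contraction property, let the two maxima on the left be attained at [u] and [v]. For any
    [y], evaluating the maxima of [g + 2 * y] and [g - 2 * y] at [u] and [v], in the better of the
    two orders, gains [2 * |y u - y v|]. *)
Lemma maxf_regular (S : finType) (p : S -> R) :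
  (forall c, 0 <= p c) -> regular_functional p maxf.
Proof.
move=> p0; split.
- by move=> g h gh; apply: maxf_ub => i; exact: le_trans (gh i) (le_maxf h i).
- move=> g c; apply/eqP; rewrite eq_le; apply/andP; split.
    by apply: maxf_ub => i; rewrite lerD2r le_maxf.
  rewrite -lerBrDr; apply: maxf_ub => i; rewrite lerBrDr.
  exact: (le_maxf (fun u => g u + c)).
- by move=> h; apply: maxf_ub => u; apply: ler_sum => c _; rewrite ler_wpM2l// le_maxf.
- move=> g h h' x x' hh'.
  have [u ->] := maxf_attained (fun u => g u + h u).
  have [v ->] := maxf_attained (fun u => g u + h' u).
  have pair y : g u + g v + 2 * `|y u - y v| <=
      maxf (fun u => g u + 2 * y u) + maxf (fun u => g u - 2 * y u).
    have := le_maxf (fun u => g u + 2 * y u) u.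
    have := le_maxf (fun u => g u + 2 * y u) v.
    have := le_maxf (fun u => g u - 2 * y u) u.
    have := le_maxf (fun u => g u - 2 * y u) v.
    by rewrite /=; case: (ger0P (y u - y v)) => ?; lra.
  by have := pair x; have := pair x'; have := hh' u v; lra.
Qed.

(** All four properties are linear in the functional and hold at every argument, so averages over
    shifted arguments inherit them. Total mass one of [p'] preserves the rule for constants, that of
    [p] preserves Jensen's inequality. *)
Lemma step_regular (S S' : finType) (p : S -> R) (p' : S' -> R) (y : S' -> V)
    (G : V -> R) :
  \sum_c p c = 1 -> (forall c, 0 <= p' c) -> \sum_c p' c = 1 ->
  regular_functional p G -> regular_functional p (step p' y G).
Proof.
move=> p1 p'0 p'1 [mono addc jensen contract]; split.
- move=> g h gh; apply: ler_sum => c _; rewrite ler_wpM2l//.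
  by apply: mono => u; rewrite lerD2r.
- move=> g c; rewrite /step.
  under eq_bigr => s _.
    rewrite (_ : (fun u => _) = fun u => (g u + y s u) + c); last first.
      by apply/funext => u; rewrite addrAC.
    rewrite addc mulrDr; over.
  by rewrite big_split/= -mulr_suml p'1 mul1r.
- move=> h; rewrite /step.
  under [leRHS]eq_bigr do rewrite mulr_sumr.
  rewrite exchange_big/=; apply: ler_sum => s _.
  under [leRHS]eq_bigr do rewrite mulrCA.
  rewrite -mulr_sumr ler_wpM2l//; apply: le_trans (jensen _).
  apply: mono => u; under [leRHS]eq_bigr do rewrite mulrDr.
  by rewrite big_split/= -mulr_suml p1 mul1r.
- move=> g h h' x x' hh'; rewrite /step -!big_split/= mulr_sumr.
  apply: ler_sum => c _; rewrite -!mulrDr mulrCA ler_wpM2l//.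
  have E z : (fun u => g u + z u + y c u) = (fun u => (g u + y c u) + z u).
    by apply/funext => u; rewrite addrAC.
  by rewrite !E; exact: contract.
Qed.

(** * Symmetrization of one block and the exponential moment after [k] blocks *)

Section Symmetrization.
Context {S : finType} (p : S -> R) (alpha beta x : S -> V).
Hypotheses (p0 : forall c, 0 <= p c) (p1 : \sum_c p c = 1).
Hypothesis beta01 : forall c u, 0 <= beta c u <= 1.
Hypothesis alpha_beta : forall c u v, 0 < p c ->
  alpha c u - beta c v <= `|x c u - x c v|.

(** Joint law of a cell and an independent fair sign. *)
Definition sgn_weight (cb : S * bool) : R := p cb.1 / 2.
Definition sgn_shift (cb : S * bool) : V :=
  fun u => if cb.2 then 2 * x cb.1 u else - (2 * x cb.1 u).
(** Indexed by pairs of a cell and a sign, so that it is averaged with the same weights as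
    [sgn_shift]. *)
Definition deviation (cb : S * bool) : V :=
  fun u => (\sum_c p c * alpha c u) - beta cb.1 u.

Lemma sum_sgn_weight (F : S * bool -> R) :
  \sum_cb sgn_weight cb * F cb = \sum_c p c * (2^-1 * (F (c, true) + F (c, false))).
Proof.
rewrite (eq_bigr (fun cb => sgn_weight (cb.1, cb.2) * F (cb.1, cb.2))) => [|[]//].
rewrite -(pair_bigA _ (fun c b => sgn_weight (c, b) * F (c, b)))/=.
by apply: eq_bigr => c _; rewrite big_bool/= /sgn_weight/=; ring.
Qed.

Lemma sgn_weight_ge0 cb : 0 <= sgn_weight cb.
Proof. by rewrite divr_ge0. Qed.

Lemma sgn_weight_sum1 : \sum_cb sgn_weight cb = 1.
Proof.
rewrite (eq_bigr (fun cb => sgn_weight cb * 1)) => [|cb _]; last by rewrite mulr1.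
by rewrite sum_sgn_weight -[RHS]p1; apply: eq_bigr => c _; field.
Qed.

(* Jensen introduces the ghost cell [c'], and the two terms obtained by
   exchanging [c] and [c'] are bounded together by [rf_contract]. *)
Lemma symmetrization_step (G : V -> R) g : regular_functional p G ->
  \sum_cb sgn_weight cb * G (fun u => g u + deviation cb u)
    <= step sgn_weight sgn_shift G g.
Proof.
move=> [mono addc jensen contract]; rewrite /step !sum_sgn_weight/=.
pose H c c' := G (fun u => g u + (alpha c' u - beta c u)).
pose K c := G (fun u => g u + 2 * x c u) + G (fun u => g u - 2 * x c u).
apply: (@le_trans _ _ (\sum_c p c * \sum_c' p c' * H c c')).
  apply: ler_sum => c _; rewrite ler_wpM2l//.
  rewrite /deviation/= -mulr2n -[X in _ * X]mulr_natl mulKf ?pnatr_eq0//.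
  apply: le_trans (jensen _); apply: mono => u.
  under [leRHS]eq_bigr do rewrite !mulrDr.
  by rewrite !big_split/= -!mulr_suml p1 !mul1r.
have swapH : \sum_c p c * \sum_c' p c' * H c c' =
    \sum_c \sum_c' p c * p c' * (2^-1 * (H c c' + H c' c)).
  under eq_bigr do rewrite mulr_sumr.
  set L := LHS.
  have L2 : L = \sum_c \sum_c' p c * p c' * H c' c.
    rewrite /L exchange_big/=; apply: eq_bigr => c _; apply: eq_bigr => c' _; ring.
  have -> : L = 2^-1 * (L + L) by field.
  rewrite {2}L2 {L2}/L -big_split/= mulr_sumr; apply: eq_bigr => c _.
  by rewrite -big_split/= mulr_sumr; apply: eq_bigr => c' _; ring.
rewrite swapH.
apply: (@le_trans _ _ (\sum_c \sum_c' p c * p c' * (2^-1 * (2^-1 * (K c + K c'))))).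
  apply: ler_sum => c _; apply: ler_sum => c' _.
  (* [alpha_beta] is available on cells of positive weight only; the remaining terms vanish. *)
  have [pc|] := ltP 0 (p c); last first.
    by move=> pc; have /eqP -> : p c == 0 by [rewrite eq_le pc p0]; rewrite !mul0r.
  have [pc'|] := ltP 0 (p c'); last first.
    by move=> pc'; have /eqP -> : p c' == 0 by [rewrite eq_le pc' p0]; rewrite mulr0 !mul0r.
  rewrite ler_wpM2l ?mulr_ge0// ler_wpM2l ?invr_ge0//.
  apply: contract => u v.
  have := alpha_beta u v pc'; have := alpha_beta v u pc.
  by rewrite [`|x c v - _|]distrC; lra.
rewrite le_eqVlt; apply/orP; left; apply/eqP.
have sp c : \sum_c' p c * p c' * (2^-1 * (2^-1 * (K c + K c'))) =
    p c * (2^-1 * (2^-1 * K c)) + p c * (\sum_c' p c' * (2^-1 * (2^-1 * K c'))).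
  rewrite (eq_bigr (fun c' => p c' * (p c * (2^-1 * (2^-1 * K c))) +
    p c * (p c' * (2^-1 * (2^-1 * K c'))))) => [|c' _]; last by ring.
  by rewrite big_split/= -mulr_suml p1 mul1r -mulr_sumr.
rewrite [LHS](eq_bigr _ (fun c _ => sp c)).
rewrite big_split/= -mulr_suml p1 mul1r -big_split/=.
by apply: eq_bigr => c _; rewrite /sgn_shift/= /K; field.
Qed.

Lemma iter_step_regular k :
  regular_functional p (iter k (step sgn_weight sgn_shift) maxf).
Proof.
elim: k => [|k IHk] /=; first exact: maxf_regular.
apply: step_regular => //; [exact: sgn_weight_ge0|exact: sgn_weight_sum1].
Qed.

(** Induction on [k], peeling off the outermost step. The induction hypothesis holds at every
    shifted argument; Hoeffding's lemma then moves the average over the outer block into the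
    exponent, and [symmetrization_step] bounds the resulting mean. *)
Lemma symmetrized_mgf_le k (l : R) g : 0 <= l ->
  iter k (step sgn_weight deviation) (fun g => expR (l * maxf g)) g <=
  expR (k%:R * (l ^+ 2 / 8)) * expR (l * iter k (step sgn_weight sgn_shift) maxf g).
Proof.
move=> l0; elim: k g => [|k IHk] g; first by rewrite mul0r expR0 mul1r.
have reg := iter_step_regular k.
rewrite !iterS; set G := iter k _ maxf in IHk reg *.
apply: (@le_trans _ _ (\sum_cb sgn_weight cb * (expR (k%:R * (l ^+ 2 / 8)) *
    expR (l * G (fun u => g u + deviation cb u))))).
  by apply: ler_sum => cb _; rewrite ler_wpM2l ?sgn_weight_ge0.
under eq_bigr do rewrite mulrCA.
rewrite -mulr_sumr -[k.+1%:R]natr1 mulrDl mul1r expRD -mulrA ler_wpM2l ?expR_ge0//.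
pose q u := \sum_c p c * alpha c u.
(* Since [beta] lies between 0 and 1, monotonicity and the rule for constants confine the values of
   [G] to an interval of length one ending at [G (g + q)]. *)
apply: le_trans (hoeffding_finite (a := G (fun u => g u + q u) - 1) l0
  sgn_weight_ge0 sgn_weight_sum1 _) _.
  move=> cb; rewrite subrK -(rf_addc reg).
  apply/andP; split; apply: (rf_mono reg) => u; rewrite /deviation -/(q u);
    by have := beta01 cb.1 u; lra.
rewrite ler_wpM2l ?expR_ge0// ler_expR ler_wpM2l//.
exact: symmetrization_step.
Qed.

End Symmetrization.
End FiniteMax.

(** * Independence of the blocks *)

Section Unique.
Context {d1 d2 : measure_display} {T1 : measurableType d1} {T2 : measurableType d2}
  {R : realType}.

(** Rectangles are closed under intersection, generate the product sigma-algebra and include the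
    whole space, where the mass is finite. *)
Lemma measure_prod_unique (m1 m2 : {measure set (T1 * T2) -> \bar R}) :
  (m1 setT < +oo)%E ->
  (forall A B, measurable A -> measurable B -> m1 (A `*` B) = m2 (A `*` B)) ->
  forall X, measurable X -> m1 X = m2 X.
Proof.
move=> m1oo m12 X mX.
pose C : set (set (T1 * T2)) :=
  [set C | exists A, measurable A /\ exists B, measurable B /\ C = A `*` B].
apply: (measure_unique C (fun=> setT)) => //.
- rewrite measurable_prod_measurableType; congr (<<s _ >>).
  rewrite predeqE; split => [[A mA [B mB <-]]|[A [mA [B [mB ->]]]]].
    by exists A; split => //; exists B.
  by exists A => //; exists B.
- move=> _ _ [A [mA [B [mB ->]]]] [A' [mA' [B' [mB' ->]]]].
  rewrite -setXI; exists (A `&` A'); split; first exact: measurableI.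
  by exists (B `&` B'); split => //; exact: measurableI.
- by move=> _; exists setT; split => //; exists setT; split => //; rewrite setXTT.
- by rewrite bigcup_const//; exists 0%N.
- by move=> _ [A [mA [B [mB ->]]]]; exact: m12.
Qed.
End Unique.

Section Indep.
Context {d d1 d2 : measure_display} {T : measurableType d} {R : realType}
  {T1 : measurableType d1} {T2 : measurableType d2} (P : probability T R).

(** Both sides are measures in [D]: the image under [Y] of [P] restricted to [A], and [K] times the
    law of [Y0]. They agree on rectangles, hence everywhere. *)
Lemma indep_pair_extend (Y Y0 : T -> T1 * T2) (A : set T) (K : {nonneg R}) :
  measurable_fun setT Y -> measurable_fun setT Y0 -> measurable A ->
  (forall B B', measurable B -> measurable B' ->
    P (Y @^-1` (B `*` B') `&` A) = (K%:num%:E * P (Y0 @^-1` (B `*` B')))%E) ->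
  forall D, measurable D -> P (Y @^-1` D `&` A) = (K%:num%:E * P (Y0 @^-1` D))%E.
Proof.
move=> mY mY0 mA H D mD.
pose Ym : {mfun T >-> (T1 * T2)%type} := HB.pack Y (isMeasurableFun.Build _ _ _ _ _ mY).
pose Y0m : {mfun T >-> (T1 * T2)%type} := HB.pack Y0 (isMeasurableFun.Build _ _ _ _ _ mY0).
have := @measure_prod_unique _ _ _ _ R (pushforward (mrestr P mA) Ym)
  (mscale K (pushforward P Y0m)) _ _ D mD; apply.
- rewrite /= /pushforward /mrestr preimage_setT setTI.
  exact: le_lt_trans (probability_le1 P mA) (ltry _).
- by move=> B B' mB mB'; exact: H.
Qed.
End Indep.

(** When [m] is odd the last index has no partner; the hypothesis makes its factor one. *)
Lemma prode_pairs (R : realType) (m : nat) (F : nat -> \bar R) :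
  (forall i, (m./2.*2 <= i)%N -> F i = 1%E) ->
  (\prod_(i < m) F i = \prod_(i < m./2) (F (2 * i)%N * F (2 * i).+1))%E.
Proof.
move=> F1; rewrite -(big_mkord xpredT F).
rewrite (big_cat_nat_idem _ (leq0n m./2.*2)) /=; last 2 first.
- exact: mul1e.
- by rewrite -[leqRHS]odd_double_half leq_addl.
rewrite [X in (_ * X)%E]big_nat_cond [X in (_ * X)%E]big1 ?mule1; last first.
  by move=> i /andP[/andP[+ _] _]; exact: F1.
elim: m./2 => [|k IHk]; first by rewrite big_geq// big_ord0.
by rewrite doubleS !big_nat_recr//= IHk big_ord_recr/= -muleA -!mul2n.
Qed.

Lemma half_lt m i : (i < m./2)%N -> (2 * i < m)%N /\ ((2 * i).+1 < m)%N.
Proof. by lia. Qed.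

Section Blocks.
Context {R : realType} {d : measure_display} {T : measurableType d}
  (P : probability T R) (n m : nat) (a : nat -> T -> 'rV[R]_n) (eps : nat -> T -> R).
Local Notation V := (n.-tuple R).
Local Notation k := (m./2).
Hypothesis m_ge2 : (2 <= m)%N.
Hypothesis ma : forall i, (i < m)%N ->
  measurable_fun [set: T] (fun w => rv2tuple (a i w)).
Hypothesis same : forall i, (i < m)%N ->
  same_law P (fun w => rv2tuple (a i w)) (fun w => rv2tuple (a 0%N w)).
Hypothesis meps : forall i, (i < k)%N -> measurable_fun [set: T] (eps i).
Hypothesis indep : indep_family P
    (fun s : ('I_m + 'I_k)%type => match s with
       | inl i => sigma_of (fun w => rv2tuple (a (val i) w))
       | inr j => sigma_of (eps (val j)) end).

Definition block i w : V * V := (rv2tuple (a (2 * i)%N w), rv2tuple (a (2 * i).+1 w)).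

Lemma measurable_block i : (i < k)%N -> measurable_fun setT (block i).
Proof.
by move=> /half_lt[i1 i2]; apply: measurable_fun_pair; exact: ma.
Qed.

Definition blocks_in (D : nat -> set (V * V)) (C : nat -> set R) : set T :=
  [set w | forall i, (i < k)%N -> D i (block i w) /\ C i (eps i w)].

Local Notation mu B := (P ((fun w => rv2tuple (a 0%N w)) @^-1` B)).

Lemma rect_indep (B B' : nat -> set V) (C : nat -> set R) :
  (forall i, measurable (B i)) -> (forall i, measurable (B' i)) ->
  (forall i, measurable (C i)) ->
  P (blocks_in (fun i => B i `*` B' i) C) =
  (\prod_(i < k) (mu (B i) * mu (B' i) * P (eps i @^-1` C i)))%E.
Proof.
move=> mB mB' mC.
(* Even rows are constrained by [B], odd rows by [B']; for odd [m] the unpaired last row is left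
   free. *)
pose BB i := if (i < k.*2)%N then if odd i then B' i./2 else B i./2 else setT.
have mBB i : measurable (BB i) by rewrite /BB; case: ifP => // _; case: ifP.
pose A (s : ('I_m + 'I_k)%type) : set T := match s with
  | inl i => (fun w => rv2tuple (a (val i) w)) @^-1` BB i
  | inr j => eps (val j) @^-1` C j end.
have := @indep [set: _]%SET A.
have -> : [set w | forall j, j \in [set: 'I_m + 'I_k]%SET -> A j w] =
    blocks_in (fun i => B i `*` B' i) C.
  apply/seteqP; split => w /= H.
    move=> i ik; have [i1 i2] := half_lt ik; split.
      have := H (inl (Ordinal i1)) (finset.in_setT _); have := H (inl (Ordinal i2)) (finset.in_setT _).
      rewrite /= /BB.
      have -> : ((2 * i).+1 < k.*2)%N by lia.
      have -> : (2 * i < k.*2)%N by lia.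
      by rewrite /= oddM/= mul2n uphalf_double doubleK.
    exact: (H (inr (Ordinal ik)) (finset.in_setT _)).
  move=> [i|j] _ /=; last by have [] := H j (ltn_ord j).
  rewrite /BB; case: ifPn => // i2k.
  have ik : (i./2 < k)%N by lia.
  have [[H1 H2] _] := H _ ik; case: ifPn => oi.
    by move: H2 => /=; rewrite mul2n (_ : (i./2.*2).+1 = i) //; lia.
  by move: H1 => /=; rewrite mul2n (_ : i./2.*2 = i) //; lia.
move=> ->; last first.
  move=> [i|j] _; rewrite /= /sigma_of /preimage_set_system/=.
    by exists (BB i) => //; rewrite setTI.
  by exists (C j) => //; rewrite setTI.
rewrite (eq_bigl xpredT) => [|s]; last by rewrite finset.in_setT.
rewrite big_sumType/= big_split/=; congr (_ * _)%E.
rewrite (eq_bigr (fun i : 'I_m => mu (BB i))) => [|i _]; last by rewrite same.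
rewrite (prode_pairs (F := fun i => mu (BB i))); last first.
  by move=> i; rewrite leqNgt /BB => /negbTE ->; rewrite preimage_setT probability_setT.
apply: eq_bigr => i _; have ik := ltn_ord i; rewrite /BB.
have -> : ((2 * i).+1 < k.*2)%N by lia.
have -> : (2 * i < k.*2)%N by lia.
by rewrite /= oddM/= mul2n uphalf_double doubleK.
Qed.

Lemma measurable_blocks_in D C : (forall i, measurable (D i)) ->
  (forall i, measurable (C i)) -> measurable (blocks_in D C).
Proof.
move=> mD mC.
have -> : blocks_in D C = \bigcap_(i in [set i | (i < k)%N])
    (block i @^-1` D i `&` eps i @^-1` C i).
  by apply/seteqP; split.
apply: bigcap_measurableType => i /= ik; apply: measurableI; rewrite -[X in measurable X]setTI.
- exact: measurable_block.
- exact: meps.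
Qed.

Lemma block0_rect (B B' : set V) : measurable B -> measurable B' ->
  P (block 0 @^-1` (B `*` B')) = (mu B * mu B')%E.
Proof.
move=> mB mB'.
have k0 : (0 < k)%N by lia.
have := @rect_indep (fun i => if i == 0%N then B else setT)
  (fun i => if i == 0%N then B' else setT) (fun=> setT).
have -> : blocks_in (fun i => (if i == 0%N then B else setT) `*`
    (if i == 0%N then B' else setT)) (fun=> setT) = block 0 @^-1` (B `*` B').
  apply/seteqP; split => w H; first by have [] := H 0%N k0.
  by move=> i ik; split => //; case: eqP => [->|_].
move=> -> => [|i|i|//]; [|by case: ifP|by case: ifP].
rewrite (bigD1 (Ordinal k0))//= [X in (_ * X)%E]big1 => [|i].
  by rewrite mule1 preimage_setT probability_setT mule1.
by rewrite -val_eqE/= => /negbTE ->; rewrite !preimage_setT probability_setT !mule1.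
Qed.

(** Independence of the rows gives the formula when every [D i] is a rectangle. The rectangles are
    then replaced by arbitrary measurable sets one block at a time, through [indep_pair_extend]. *)
Lemma blocks_indep D C : (forall i, measurable (D i)) ->
  (forall i, measurable (C i)) ->
  P (blocks_in D C) =
  (\prod_(i < k) (P (block 0 @^-1` D i) * P (eps i @^-1` C i)))%E.
Proof.
move=> mD mC.
have k0 : (0 < k)%N by lia.
(* The sets at indices below [l] are arbitrary; those from [l] on are still rectangles. *)
suff H l : (l <= k)%N -> forall D, (forall i, measurable (D i)) ->
  (forall i, (l <= i < k)%N -> exists BB : set V * set V,
    [/\ measurable BB.1, measurable BB.2 & D i = BB.1 `*` BB.2]) ->
  P (blocks_in D C) =
  (\prod_(i < k) (P (block 0 @^-1` D i) * P (eps i @^-1` C i)))%E.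
  by apply: (H k) => // i; lia.
elim: l => [_ {}D {}mD rectD|l IHl lk {}D {}mD rectD].
  have /choice[BB BBE] : forall i, exists BB : set V * set V,
      [/\ measurable BB.1, measurable BB.2 & (i < k)%N -> D i = BB.1 `*` BB.2].
    move=> i; have [ik|ki] := ltnP i k.
      by have [BB [? ? ?]] := rectD i ik; exists BB; split.
    by exists (setT, setT); split; [exact: measurableT|exact: measurableT|].
  have -> : blocks_in D C = blocks_in (fun i => (BB i).1 `*` (BB i).2) C.
    by apply/seteqP; split => w H i ik; have [_ _ E] := BBE i;
      have := H i ik; rewrite /= E.
  rewrite rect_indep// => [|i|i]; [|by have [] := BBE i|by have [] := BBE i].
  apply: eq_bigr => i _; have [? ? ->//] := BBE i.
  by rewrite block0_rect.
pose D' X i := if i == l then X else D i.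
have mD' X i : measurable X -> measurable (D' X i) by rewrite /D'; case: eqP.
(* All the constraints except the one on block [l], whose sign stays constrained. *)
pose A := blocks_in (D' setT) C.
have AE X : block l @^-1` X `&` A = blocks_in (D' X) C.
  apply/seteqP; split => [w [Xl Aw] i ik|w H].
    by have [+ Ci] := Aw i ik; rewrite /D'; case: eqP => [il|//]; rewrite il in Ci *.
  have := H l lk; rewrite {1}/D' eqxx => -[Xl Cl]; split => // i ik.
  by have := H i ik; rewrite /D'; case: eqP => // _ [].
pose K : \bar R := (P (eps l @^-1` C l) * \prod_(i < k | i != Ordinal lk)
  (P (block 0 @^-1` D i) * P (eps i @^-1` C i)))%E.
have prodE X : (\prod_(i < k) (P (block 0 @^-1` D' X i) * P (eps i @^-1` C i)) =
    K * P (block 0 @^-1` X))%E.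
  rewrite (bigD1 (Ordinal lk))//= {1}/D' eqxx [RHS]muleC muleA; congr (_ * _)%E.
  by apply: eq_bigr => i; rewrite -val_eqE /D' /= => /negbTE ->.
have K_fin : K \is a fin_num.
  rewrite fin_numM ?fin_num_measure//; first by rewrite -[X in measurable X]setTI; exact: meps.
  apply: prode_fin_num => i _.
  by rewrite fin_numM ?fin_num_measure//; rewrite -[X in measurable X]setTI;
    [exact: measurable_block|exact: meps].
have K_ge0 : 0 <= fine K.
  by rewrite fine_ge0// mule_ge0// prode_ge0// => i _; rewrite mule_ge0.
have D'D : D' (D l) = D by apply/funext => i; rewrite /D'; case: eqP => [->|].
rewrite -D'D prodE -AE -(fineK K_fin).
apply: (@indep_pair_extend _ _ _ _ _ _ _ _ _ _ _ (NngNum K_ge0)) => //.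
- exact: measurable_block.
- exact: measurable_block.
- by apply: measurable_blocks_in => // i; exact: mD'.
- move=> B B' mB mB'; rewrite AE /= fineK// -prodE.
  apply: IHl; [exact: ltnW|by move=> i; apply: mD'; exact: measurableX|].
  move=> i /andP[li ik]; rewrite /D'; case: eqP => [_|/eqP il].
    by exists (B, B').
  by apply: rectD; rewrite ik andbT ltn_neqAle eq_sym il.
Qed.

End Blocks.

(** * Integration over cells *)

Section Restriction.
Local Open Scope ereal_scope.
Context {d d1 : measure_display} {T : measurableType d} {U : measurableType d1}
  {R : realType} (mu : {measure set T -> \bar R}).

Lemma ge0_integral_mrestr (A D : set T) (mA : measurable A) (f : T -> \bar R) :
  measurable D -> measurable_fun D f -> (forall x, D x -> 0 <= f x) ->
  \int[mrestr mu mA]_(x in D) f x = \int[mu]_(x in D `&` A) f x.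
Proof.
move=> mD mf f0.
rewrite (@ge0_negligible_integral _ _ _ (mrestr mu mA) D (~` A))//; last 2 first.
- exact: measurableC.
- by rewrite /= /mrestr setICl measure0.
rewrite setDE setCK; apply: (eq_measure_integral mu) => B mB BDA.
by rewrite /= /mrestr setIidl// => x /BDA[].
Qed.

(** The hypothesis on events says that the image under [Y] of [mu] restricted to [A] is [K] times
    the image of [mu] under [Y0]; changing variables on both sides turns this into an identity of
    integrals. *)
Lemma ge0_integral_indep (Y Y0 : T -> U) (A : set T) (K : {nonneg R})
    (D : set U) (f : U -> \bar R) :
  measurable_fun setT Y -> measurable_fun setT Y0 -> measurable A ->
  (forall B, measurable B -> mu (Y @^-1` B `&` A) = K%:num%:E * mu (Y0 @^-1` B)) ->
  measurable D -> measurable_fun D f -> (forall x, D x -> 0 <= f x) ->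
  \int[mu]_(w in Y @^-1` D `&` A) f (Y w) =
  K%:num%:E * \int[mu]_(w in Y0 @^-1` D) f (Y0 w).
Proof.
move=> mY mY0 mA H mD mf f0.
pose Ym : {mfun T >-> U} := HB.pack Y (isMeasurableFun.Build _ _ _ _ _ mY).
pose Y0m : {mfun T >-> U} := HB.pack Y0 (isMeasurableFun.Build _ _ _ _ _ mY0).
have mYD : measurable (Y @^-1` D) by rewrite -[X in measurable X]setTI; exact: (mY measurableT).
have mfY : measurable_fun (Y @^-1` D) (f \o Y).
  by apply: (measurable_comp mD) => //; [move=> _ [x /= ? <-]|exact: measurable_funTS].
rewrite -(ge0_integral_mrestr mA mYD mfY); last by move=> x; exact: f0.
have f0' : {in D, forall y, 0 <= f y} by move=> y /[!inE]; exact: f0.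
have := @ge0_integral_pushforward _ _ _ _ _ Ym mY (mrestr mu mA) D f mD mf f0'.
move=> <-.
have := @ge0_integral_pushforward _ _ _ _ _ Y0m mY0 mu D f mD mf f0'.
move=> <-.
rewrite -ge0_integral_mscale//.
by apply: (eq_measure_integral (mscale K (pushforward mu Y0m))) => B mB _; exact: H.
Qed.

End Restriction.

(** * Partition of the space by the cells of the blocks, and induction along it *)

Section CellPartition.
Context {R : realType} {S : finType} {T : Type} (k : nat) (C : nat -> T -> S).

(** The first [j] blocks are free, being already integrated out: [cell s 0] prescribes every block
    and [cell s k] is the whole space. *)
Definition cell (s : nat -> S) j : set T := [set w | forall i, (j <= i < k)%N -> C i w = s i].

Definition upd (s : nat -> S) j c : nat -> S := fun i => if i == j then c else s i.

Lemma cell_bigsetU s j : (j < k)%N ->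
  cell s j.+1 = \big[setU/set0]_(c <- index_enum S) cell (upd s j c) j.
Proof.
move=> jk; rewrite -bigcup_seq; apply/seteqP; split => [w H|w [c _ H]].
  exists (C j w); first by rewrite /= mem_index_enum.
  move=> i /andP[ji ik]; rewrite /upd; case: eqP => [->//|/eqP ij].
  by apply: H; rewrite ik andbT ltn_neqAle eq_sym ij.
by move=> i /andP[ji ik]; have := H i; rewrite /upd gtn_eqF// ik (ltnW ji); exact.
Qed.

Lemma trivIset_cell s j : (j < k)%N -> trivIset setT (fun c => cell (upd s j c) j).
Proof.
move=> jk; apply/trivIsetP => c c' _ _; apply: contra_neqP.
move=> /eqP/set0P[w [/(_ j)+ /(_ j)]].
by rewrite jk leqnn /upd eqxx => <-// <-.
Qed.

Lemma cell_all s : cell s k = setT.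
Proof. by apply/seteqP; split => // w _ i /andP[]; lia. Qed.

(** Backward induction over the blocks: freeing block [j] sums [m] over its possible cells, and on
    the side of the bound this sum is one application of [step]. *)
Lemma additive_cells_le {N : nat} (m : set T -> R) (p : S -> R)
    (y : S -> 'I_N.+1 -> R) (f : ('I_N.+1 -> R) -> R) (s : nat -> S) :
  (forall c, 0 <= p c) ->
  (forall j s, (j < k)%N -> m (cell s j.+1) = \sum_c m (cell (upd s j c) j)) ->
  (forall s, m (cell s 0) <=
    (\prod_(0 <= i < k) p (s i)) * f (fun u => \sum_(0 <= i < k) y (s i) u)) ->
  m setT <= iter k (step p y) f (fun=> 0).
Proof.
move=> p0 madd base; rewrite -(cell_all s).
suff H j : (j <= k)%N -> forall s, m (cell s j) <=
    (\prod_(j <= i < k) p (s i)) *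
    iter j (step p y) f (fun u => \sum_(j <= i < k) y (s i) u).
  apply: (le_trans (H k (leqnn k) s)); rewrite big_geq// mul1r.
  rewrite (_ : (fun=> 0) = fun u => \sum_(k <= i < k) y (s i) u)//.
  by apply/funext => u; rewrite big_geq.
elim: j => [_|j IHj jk] {}s; first exact: base.
rewrite madd// iterS {1}/step mulr_sumr; apply: ler_sum => c _.
apply: (le_trans (IHj (ltnW jk) _)).
rewrite (big_ltn jk) {1}/upd eqxx -mulrA mulrCA.
have updE i : (j.+1 <= i < k)%N -> upd s j c i = s i.
  by move=> /andP[ji _]; rewrite /upd gtn_eqF.
have -> : \prod_(j.+1 <= i < k) p (upd s j c i) = \prod_(j.+1 <= i < k) p (s i).
  by apply: eq_big_nat => i /updE ->.
(* Prescribing the cell [c] for block [j] adds the shift [y c] and leaves the later summands as they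
   are. *)
have -> : (fun u => \sum_(j <= i < k) y (upd s j c i) u) =
    (fun u => \sum_(j.+1 <= i < k) y (s i) u + y c u).
  apply/funext => u; rewrite (big_ltn jk) {1}/upd eqxx addrC; congr (_ + _).
  by apply: eq_big_nat => i /updE ->.
exact: lexx.
Qed.

Lemma iter_stepN {N : nat} (p : S -> R) (y : S -> 'I_N.+1 -> R) j
    (f : ('I_N.+1 -> R) -> R) g :
  iter j (step p y) (fun g => - f g) g = - iter j (step p y) f g.
Proof.
elim: j g => //= j IHj g; rewrite /step -sumrN.
by apply: eq_bigr => c _; rewrite IHj mulrN.
Qed.

(** The upper bound applied to [- m] and [- f], as iterates of [step] commute with negation. *)
Lemma additive_cells_ge {N : nat} (m : set T -> R) (p : S -> R)
    (y : S -> 'I_N.+1 -> R) (f : ('I_N.+1 -> R) -> R) (s : nat -> S) :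
  (forall c, 0 <= p c) ->
  (forall j s, (j < k)%N -> m (cell s j.+1) = \sum_c m (cell (upd s j c) j)) ->
  (forall s, (\prod_(0 <= i < k) p (s i)) *
    f (fun u => \sum_(0 <= i < k) y (s i) u) <= m (cell s 0)) ->
  iter k (step p y) f (fun=> 0) <= m setT.
Proof.
move=> p0 madd base; rewrite -lerN2 -iter_stepN.
apply: (@additive_cells_le _ (fun A => - m A)) => // [j s' jk|s'].
  by rewrite madd// sumrN.
by rewrite mulrN lerN2.
Qed.

End CellPartition.

(** * The deviation inequality for finitely many vectors *)

Lemma Rintegral_partition {d : measure_display} {T : measurableType d} {R : realType}
    (mu : {measure set T -> \bar R}) (S : finType) (F : S -> set T) (A : set T)
    (phi : T -> R) :
  (forall c, measurable (F c)) -> trivIset setT F ->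
  A = \big[setU/set0]_(c <- index_enum S) F c ->
  mu.-integrable A (EFin \o phi) ->
  \int[mu]_(w in A) phi w = \sum_c \int[mu]_(w in F c) phi w.
Proof.
move=> mF tF -> iphi.
rewrite /Rintegral integral_bigsetU_EFin//; last 3 first.
- exact: index_enum_uniq.
- exact: sub_trivIset tF.
- exact: measurable_int iphi.
rewrite sum_fine// => c _; apply: integrable_fin_num => //.
apply: integrableS iphi => //; first exact: bigsetU_measurable.
by rewrite -bigcup_seq; apply: bigcup_sup; rewrite /= mem_index_enum.
Qed.

Lemma measurable_maxf {d : measure_display} {T : measurableType d} {R : realType}
    {N : nat} (g : T -> 'I_N.+1 -> R) :
  (forall u, measurable_fun setT (fun w => g w u)) ->
  measurable_fun setT (fun w => maxf (g w)).
Proof.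
move=> mg; rewrite /maxf; elim: (index_enum _) => [|u s IHs].
  by rewrite (_ : (fun w => _) = fun w => g w ord0)//; apply/funext => w; rewrite big_nil.
rewrite (_ : (fun w => _) = fun w => Num.max (g w u) (\big[Num.max/g w ord0]_(i <- s) g w i)).
  exact: measurable_maxr.
by apply/funext => w; rewrite big_cons.
Qed.

Lemma set1_ifP {R : realType} (r : R) (b : bool) :
  (if b then [set 1] else ~` [set 1]) r <-> (r == 1) = b.
Proof.
case: b; split => /=; [by move=> ->; rewrite eqxx|by move/eqP|by move/eqP/negbTE|].
by move=> H /eqP; rewrite H.
Qed.

Section Deviation.
Context {R : realType} {d dU : measure_display} {T : measurableType d}
  {U : measurableType dU} (P : probability T R) (k N : nat)
  (Y : nat -> T -> U) (eps : nat -> T -> R) (X : U -> 'I_N.+1 -> R) (xi : R).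
Hypothesis k_gt0 : (0 < k)%N.
Hypothesis xi_gt0 : 0 < xi.
Hypothesis mY : forall i, (i < k)%N -> measurable_fun setT (Y i).
Hypothesis mX : forall u, measurable_fun setT (fun y => X y u).
Hypothesis rad : forall i, (i < k)%N -> rademacher P (eps i).
Hypothesis indep : forall (D : nat -> set U) (C : nat -> set R),
  (forall i, measurable (D i)) -> (forall i, measurable (C i)) ->
  P [set w | forall i, (i < k)%N -> D i (Y i w) /\ C i (eps i w)] =
  (\prod_(i < k) (P (Y 0 @^-1` D i) * P (eps i @^-1` C i)))%E.

(* The sign is recorded so that the mean of a coordinate over a cell on which
   [2 * xi <= `|r|] still has absolute value at least [2 * xi]. *)
Definition level (r : R) : bool * bool * bool := (0 <= r, xi <= `|r|, 2 * xi <= `|r|).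
Definition pattern (y : U) : {ffun 'I_N.+1 -> bool * bool * bool} :=
  [ffun u => level (X y u)].
Definition cell_of i w := (pattern (Y i w), eps i w == 1).
Definition atom c : set T := Y 0 @^-1` (pattern @^-1` [set c]).
Definition pweight c : R := fine (P (atom c)).
(** It agrees with [eps] almost surely, but takes the values 1 and -1 only and is a function of the
    cell at every point. *)
Definition sg i w : R := if eps i w == 1 then 1 else -1.

Lemma measurable_preY i D : (i < k)%N -> measurable D -> measurable (Y i @^-1` D).
Proof. by move=> ik mD; rewrite -[X in measurable X]setTI; exact: (mY ik measurableT). Qed.

Lemma measurable_sg_event i b : (i < k)%N -> measurable [set w | (eps i w == 1) = b].
Proof.
move=> ik; have [meps _] := rad ik.
have -> : [set w | (eps i w == 1) = b] = eps i @^-1` (if b then [set 1] else ~` [set 1]).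
  by apply/seteqP; split => w /set1_ifP.
rewrite -[X in measurable X]setTI; apply: (meps measurableT).
by case: b => //; exact: measurableC.
Qed.

Lemma measurable_pattern c : measurable (pattern @^-1` [set c]).
Proof.
have -> : pattern @^-1` [set c] = \bigcap_(u in [set: 'I_N.+1])
    [set y | level (X y u) = c u].
  apply/seteqP; split => [y /= <- u _|y H /=]; first by rewrite /= ffunE.
  by apply/ffunP => u; rewrite ffunE; exact: H.
apply: fin_bigcap_measurable => // u _.
have mb (f : U -> bool) b : measurable_fun setT f -> measurable [set y | f y = b].
  by move=> mf; rewrite -[X in measurable X]setTI; exact: (mf measurableT [set b]).
have mN : measurable_fun setT (fun y => `|X y u|) by exact: measurableT_comp.
case: (c u) => -[b1 b2] b3.
have -> : [set y | level (X y u) = (b1, b2, b3)] = [set y | (0 <= X y u) = b1] `&`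
    [set y | (xi <= `|X y u|) = b2] `&` [set y | (2 * xi <= `|X y u|) = b3].
  by apply/seteqP; split => y /=; rewrite /level; [case=> <- <- <-|case=> -[<- <- <-]].
by apply: measurableI; [apply: measurableI|]; apply: mb; exact: measurable_fun_ler.
Qed.

Lemma measurable_atom c : measurable (atom c).
Proof. by apply: measurable_preY => //; exact: measurable_pattern. Qed.

Lemma sg_prob i b : (i < k)%N -> P [set w | (eps i w == 1) = b] = (2^-1)%:E.
Proof.
move=> ik; have [meps [P1 PN1]] := rad ik.
have E1 : [set w | (eps i w == 1) = true] = [set w | eps i w = 1].
  by apply/seteqP; split => w /=; move/eqP.
case: b; first by rewrite E1.
have -> : [set w | (eps i w == 1) = false] = ~` [set w | eps i w = 1].
  by apply/seteqP; split => w /(@set1_ifP _ _ false).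
rewrite probability_setC.
  by rewrite P1 -EFinB; congr EFin; field.
by rewrite -E1; exact: measurable_sg_event.
Qed.

Lemma indep_sg (D : nat -> set U) (b : nat -> bool) : (forall i, measurable (D i)) ->
  P [set w | forall i, (i < k)%N -> D i (Y i w) /\ (eps i w == 1) = b i] =
  (\prod_(i < k) (fine (P (Y 0 @^-1` D i)) / 2))%:E.
Proof.
move=> mD; have := indep (C := fun i => if b i then [set 1] else ~` [set 1]) mD.
have -> : [set w | forall i, (i < k)%N ->
    D i (Y i w) /\ (if b i then [set 1] else ~` [set 1]) (eps i w)] =
    [set w | forall i, (i < k)%N -> D i (Y i w) /\ (eps i w == 1) = b i].
  by apply/seteqP; split => w /= H i ik; have [? ?] := H i ik; split => //; exact/set1_ifP.
move=> ->; last by move=> i; case: (b i) => //; exact: measurableC.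
rewrite -prodEFin; apply: eq_bigr => i _.
rewrite EFinM fineK ?fin_num_measure//; last exact: measurable_preY.
by congr (_ * _)%E; rewrite -(sg_prob (b i) (ltn_ord i)); congr (P _); apply/seteqP; split => w /set1_ifP.
Qed.

Local Notation S := ({ffun 'I_N.+1 -> bool * bool * bool} * bool)%type.
Local Notation cells := (cell k cell_of).

Lemma cells0E s : cells s 0 = [set w | forall i, (i < k)%N ->
  (pattern @^-1` [set (s i).1]) (Y i w) /\ (eps i w == 1) = (s i).2].
Proof.
apply/seteqP; split => w H i ik; first by have := H i ik; rewrite /cell_of => <-.
by case: (H i ik) => /=; rewrite /cell_of => -> ->; rewrite -surjective_pairing.
Qed.

Lemma measurable_cells s j : measurable (cells s j).
Proof.
have -> : cells s j = \bigcap_(i in [set i | (j <= i < k)%N])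
    (Y i @^-1` (pattern @^-1` [set (s i).1]) `&` [set w | (eps i w == 1) = (s i).2]).
  apply/seteqP; split => w H i ik; first by have := H i ik; rewrite /cell_of => <-.
  by case: (H i ik) => /=; rewrite /cell_of => -> ->; rewrite -surjective_pairing.
apply: bigcap_measurableType => i /= /andP[_ ik]; apply: measurableI.
  by apply: measurable_preY => //; exact: measurable_pattern.
exact: measurable_sg_event.
Qed.

Lemma prob_cells s : P (cells s 0) = (\prod_(0 <= i < k) sgn_weight pweight (s i))%:E.
Proof.
rewrite cells0E (@indep_sg (fun i => pattern @^-1` [set (s i).1]) (fun i => (s i).2)).
  by rewrite big_mkord.
by move=> i; exact: measurable_pattern.
Qed.

(** What [cells s 0] prescribes apart from the pattern of block [i]; this event is independent of
    that block. *)
Definition others (s : nat -> S) i : set T := [set w | forall j, (j < k)%N ->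
  (if j == i then setT else pattern @^-1` [set (s j).1]) (Y j w) /\
  (eps j w == 1) = (s j).2].

(** The probability of [others s i] for [i < k]; the factor [2^-1] belongs to the sign of block
    [i]. *)
Definition others_weight (s : nat -> S) i : R :=
  2^-1 * \prod_(j < k | val j != i) sgn_weight pweight (s j).

Lemma pweight_ge0 c : 0 <= pweight c.
Proof. by rewrite fine_ge0. Qed.

Lemma others_weight_ge0 s i : 0 <= others_weight s i.
Proof.
rewrite mulr_ge0 ?invr_ge0// prodr_ge0// => j _.
by apply: sgn_weight_ge0; exact: pweight_ge0.
Qed.

Lemma others_weightE s i : (i < k)%N ->
  \prod_(0 <= j < k) sgn_weight pweight (s j) = others_weight s i * pweight (s i).1.
Proof.
move=> ik; rewrite big_mkord (bigD1 (Ordinal ik))//= {1}/sgn_weight /others_weight.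
by rewrite mulrAC mulrC -!mulrA; congr (_ * _); rewrite mulrC.
Qed.

Lemma measurable_others s i : measurable (others s i).
Proof.
have -> : others s i = \bigcap_(j in [set j | (j < k)%N])
    (Y j @^-1` (if j == i then setT else pattern @^-1` [set (s j).1]) `&`
     [set w | (eps j w == 1) = (s j).2]).
  by apply/seteqP; split.
apply: bigcap_measurableType => j /= jk; apply: measurableI.
  by apply: measurable_preY => //; case: eqP => // _; exact: measurable_pattern.
exact: measurable_sg_event.
Qed.

Lemma others_indep s i B : (i < k)%N -> measurable B ->
  P (Y i @^-1` B `&` others s i) = ((others_weight s i)%:E * P (Y 0 @^-1` B))%E.
Proof.
move=> ik mB.
have -> : Y i @^-1` B `&` others s i = [set w | forall j, (j < k)%N ->
    (if j == i then B else pattern @^-1` [set (s j).1]) (Y j w) /\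
    (eps j w == 1) = (s j).2].
  apply/seteqP; split => [w [Bw H] j jk|w H].
    by case: (H j jk); case: eqP => // ->.
  split; first by have [] := H i ik; rewrite eqxx.
  by move=> j jk; case: (H j jk); case: eqP.
rewrite (@indep_sg (fun j => if j == i then B else pattern @^-1` [set (s j).1])
  (fun j => (s j).2)); last by move=> j; case: eqP => // _; exact: measurable_pattern.
have fB : P (Y 0 @^-1` B) \is a fin_num by rewrite fin_num_measure//; exact: measurable_preY.
rewrite -(fineK fB) -EFinM; congr EFin.
rewrite (bigD1 (Ordinal ik))//= eqxx /others_weight [RHS]mulrC mulrA.
congr (_ * _); apply: eq_big => // j.
by rewrite -val_eqE /= => /negbTE ->.
Qed.

Lemma cells0_others s i : (i < k)%N ->
  cells s 0 = Y i @^-1` (pattern @^-1` [set (s i).1]) `&` others s i.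
Proof.
move=> ik; rewrite cells0E; apply/seteqP; split => [w H|w [Yi H] j jk].
  split; first by have [] := H i ik.
  by move=> j jk; have [? ?] := H j jk; split => //; case: eqP.
by have [] := H j jk; case: eqP => [->|//].
Qed.

Lemma ge0_integral_cells s i (f : U -> \bar R) : (i < k)%N ->
  measurable_fun setT f -> (forall y, 0 <= f y)%E ->
  (\int[P]_(w in cells s 0) f (Y i w) =
   (others_weight s i)%:E * \int[P]_(w in atom (s i).1) f (Y 0 w))%E.
Proof.
move=> ik mf f0; rewrite (cells0_others s ik).
apply: (@ge0_integral_indep _ _ _ _ _ _ _ _ _ (NngNum (others_weight_ge0 s i))) => //.
- exact: mY.
- exact: mY.
- exact: measurable_others.
- by move=> B mB /=; exact: others_indep.
- exact: measurable_pattern.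
- exact: measurable_funTS.
Qed.

(** All blocks have the law of block 0: this is the product formula of [indep] with a constraint on
    block [i] alone. *)
Lemma ge0_integral_copy i (f : U -> \bar R) : (i < k)%N ->
  measurable_fun setT f -> (forall y, 0 <= f y)%E ->
  (\int[P]_w f (Y i w) = \int[P]_w f (Y 0 w))%E.
Proof.
move=> ik mf f0.
have YT j : Y j @^-1` setT `&` setT = setT by rewrite preimage_setT setTI.
rewrite -{1}(YT i) -[RHS]mul1e -(preimage_setT (Y 0)).
apply: (@ge0_integral_indep _ _ _ _ _ P _ _ _ (NngNum ler01)) => //;
  [exact: mY|exact: mY|by rewrite preimage_setT|].
move=> B mB; rewrite preimage_setT setIT /= mul1e.
have mD j : measurable (if j == i then B else setT) by case: eqP.
have := indep (C := fun=> setT) mD; rewrite (bigD1 (Ordinal ik))//= eqxx big1 => [|j].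
  rewrite preimage_setT probability_setT !mule1 => <-//.
  congr (P _); apply/seteqP; split => [w Bw j jk|w /(_ i ik)[]]; last by rewrite eqxx.
  by case: eqP => [->|].
by rewrite -val_eqE/= => /negbTE ->; rewrite !preimage_setT probability_setT mule1.
Qed.

Lemma atoms_bigsetU : [set: T] = \big[setU/set0]_(c <- index_enum _) atom c.
Proof.
rewrite -bigcup_seq; apply/seteqP; split => // w _.
by exists (pattern (Y 0 w)); rewrite //= mem_index_enum.
Qed.

Lemma trivIset_atom : trivIset setT atom.
Proof.
apply/trivIsetP => c c' _ _; apply: contra_neqP => /eqP/set0P[w [/= <- <-]] //.
Qed.

Lemma pweight_sum1 : \sum_c pweight c = 1.
Proof.
have := Rintegral_partition measurable_atom trivIset_atom atoms_bigsetU
  (finite_measure_integrable_cst P 1%R measurableT).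
rewrite Rintegral_cst// mul1r [X in fine X]probability_setT /= => ->.
by apply: eq_bigr => c _; rewrite Rintegral_cst ?mul1r//; exact: measurable_atom.
Qed.

(** In the triples built by [level], [.2] is the test at [2 * xi], [.1.2] the test at [xi] and
    [.1.1] the sign. *)
Definition alpha (c : {ffun 'I_N.+1 -> bool * bool * bool}) u : R := (c u).2%:R.
Definition beta (c : {ffun 'I_N.+1 -> bool * bool * bool}) u : R := (c u).1.2%:R.
(* The conditional mean of [X (Y 0) u / xi] given [atom c]; it is 0 on atoms of
   probability 0. *)
Definition bary c u : R := xi^-1 * ((\int[P]_(w in atom c) X (Y 0 w) u) / pweight c).

Lemma sum_alpha u : \sum_c pweight c * alpha c u =
  fine (P [set w | 2 * xi <= `|X (Y 0 w) u|]).
Proof.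
set B := [set w | _].
have mB : measurable B.
  have -> : B = Y 0 @^-1` [set y | (2 * xi <= `|X y u|) = true] by [].
  apply: measurable_preY => //.
  rewrite -[X in measurable X]setTI.
  have : measurable_fun setT (fun y => 2 * xi <= `|X y u|).
    by apply: measurable_fun_ler => //; exact: measurableT_comp.
  by move=> /(_ measurableT [set true]); exact.
have := Rintegral_partition measurable_atom trivIset_atom atoms_bigsetU
  (integrable_indic P mB).
rewrite {1}/Rintegral integral_indic// setIT => ->.
apply: eq_bigr => c _; rewrite /Rintegral integral_indic//; last exact: measurable_atom.
rewrite /pweight /alpha; case: (boolP (c u).2) => cu.
  rewrite mulr1; congr (fine (P _)); apply/seteqP; split => [w /=|w []//].
  by move=> Yc; split => //; move: cu; rewrite -Yc /= ffunE.
rewrite mulr0 (_ : _ `&` _ = set0) ?measure0//; apply/seteqP; split => // w [/= Bw Yc].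
by move: cu; rewrite -Yc ffunE /= Bw.
Qed.

Definition signed_sum u w : R := \sum_(0 <= i < k) sg i w * X (Y i w) u.
Hypothesis signed_sum_fin : forall u,
  (\int[P]_w (Num.max (signed_sum u w) 0)%:E < +oo)%E.

Lemma measurable_XY i u : (i < k)%N -> measurable_fun setT (fun w => X (Y i w) u).
Proof. by move=> ik; apply: (measurableT_comp (mX u)); exact: mY. Qed.

Lemma measurable_sg i : (i < k)%N -> measurable_fun setT (sg i).
Proof.
move=> ik; apply: measurable_fun_ifT => //.
by apply: (measurable_fun_bool true); rewrite setTI; exact: (@measurable_sg_event i true).
Qed.

Lemma measurable_signed_sum u : measurable_fun setT (signed_sum u).
Proof.
rewrite /signed_sum.
rewrite (_ : (fun w => _) = fun w => \sum_(i < k) sg i w * X (Y i w) u).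
  apply: measurable_sum => i; apply: measurable_funM.
    exact: measurable_sg.
  exact: measurable_XY.
by apply/funext => w; rewrite big_mkord.
Qed.

(* On the cell where every block has pattern [c] and every sign agrees with
   the sign of the [u]-th coordinate prescribed by [c], nothing cancels in [signed_sum]. *)
Lemma atom_integral_fin c u : (\int[P]_(w in atom c) `|X (Y 0 w) u|%:E < +oo)%E.
Proof.
have mabs : measurable_fun setT (fun y => `|X y u|%:E).
  by apply/measurable_EFinP; exact: measurableT_comp.
have [pc0|pc0] := eqVneq (pweight c) 0.
  rewrite null_set_integral//.
  - exact: measurable_atom.
  - apply: measurable_funTS; apply: (measurableT_comp mabs); exact: mY.
  - by rewrite -[LHS]fineK ?fin_num_measure -/(pweight c) ?pc0//; exact: measurable_atom.
have pc : 0 < pweight c by rewrite lt_neqAle eq_sym pc0 pweight_ge0.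
pose s : nat -> S := fun=> (c, (c u).1.1).
have kap : 0 < others_weight s 0.
  by rewrite mulr_gt0 ?invr_gt0// prodr_gt0// => j _; rewrite divr_gt0.
have := @ge0_integral_cells s 0 (fun y => `|X y u|%:E) k_gt0 mabs (fun y => ltac:(by rewrite lee_fin)).
move=> E.
have : ((others_weight s 0)%:E * \int[P]_(w in atom c) `|X (Y 0 w) u|%:E < +oo)%E.
  rewrite -E; apply: le_lt_trans (signed_sum_fin u).
  have mmax : measurable_fun setT (fun w => (Num.max (signed_sum u w) 0)%:E).
    by apply/measurable_EFinP; apply: measurable_maxr => //; exact: measurable_signed_sum.
  apply: (@le_trans _ _ (\int[P]_(w in cell k cell_of s 0) (Num.max (signed_sum u w) 0)%:E)%E).
    apply: ge0_le_integral => //.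
    - exact: measurable_cells.
    - by apply: measurable_funTS; apply: (measurableT_comp mabs); exact: mY.
    - exact: measurable_funTS.
    move=> w; rewrite cells0E => H; rewrite lee_fin le_max; apply/orP; left.
    have Hi i : (i < k)%N -> sg i w * X (Y i w) u = `|X (Y i w) u|.
      move=> /H[/= Yi ei]; rewrite /sg ei -Yi ffunE /=.
      by case: ger0P; rewrite ?mul1r ?mulN1r.
    rewrite /signed_sum big_ltn// Hi// lerDl big_nat_cond sumr_ge0// => i.
    by move=> /andP[/andP[_ ik] _]; rewrite Hi.
  apply: ge0_subset_integral => //; first exact: measurable_cells.
  by move=> w _; rewrite lee_fin le_max lexx orbT.
have : (0 <= \int[P]_(w in atom c) `|X (Y 0 w) u|%:E)%E.
  by apply: integral_ge0 => w _; rewrite lee_fin.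
case: (\int[P]_(w in _) _)%E => [r _ _|_|//]; first exact: ltry.
by rewrite mulry gtr0_sg// mul1e ltxx.
Qed.

(** The integral of the absolute value is carried over to block 0 and split over the finitely many
    atoms, each of which contributes a finite amount. *)
Lemma integrable_XY i u : (i < k)%N -> P.-integrable setT (fun w => (X (Y i w) u)%:E).
Proof.
move=> ik; apply/integrableP; split; first by apply/measurable_EFinP; exact: measurable_XY.
rewrite (@ge0_integral_copy i (fun y => `|X y u|%:E))//; last first.
  by apply/measurable_EFinP; exact: measurableT_comp.
rewrite atoms_bigsetU ge0_integral_bigsetU//.
- by apply: lte_sum_pinfty => c _; exact: atom_integral_fin.
- exact: measurable_atom.
- exact: index_enum_uniq.
- exact: sub_trivIset trivIset_atom.
- apply: measurable_funTS; apply/measurable_EFinP; apply: measurableT_comp => //.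
  exact: measurable_XY.
Qed.

(** [ge0_integral_cells] handles the positive and the negative part; integrability allows the
    subtraction. *)
Lemma Rintegral_cells s i u : (i < k)%N ->
  \int[P]_(w in cell k cell_of s 0) X (Y i w) u =
  others_weight s i * \int[P]_(w in atom (s i).1) X (Y 0 w) u.
Proof.
move=> ik; rewrite /Rintegral.
have iat : P.-integrable (atom (s i).1) (fun w => (X (Y 0 w) u)%:E).
  by apply: integrableS (integrable_XY u k_gt0) => //; exact: measurable_atom.
pose g y := (X y u)%:E.
have mg : measurable_fun setT g by apply/measurable_EFinP.
have Ep : (\int[P]_(w in cell k cell_of s 0) (fun w => (X (Y i w) u)%:E)^\+ w =
    (others_weight s i)%:E * \int[P]_(w in atom (s i).1) (fun w => (X (Y 0 w) u)%:E)^\+ w)%E.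
  have E j : ((fun w => (X (Y j w) u)%:E)^\+ = fun w => g^\+ (Y j w))%E.
    exact: (funepos_comp g (Y j)).
  rewrite !E; exact: (@ge0_integral_cells s i (g^\+)%E ik (measurable_funepos mg) (funepos_ge0 g)).
have En : (\int[P]_(w in cell k cell_of s 0) (fun w => (X (Y i w) u)%:E)^\- w =
    (others_weight s i)%:E * \int[P]_(w in atom (s i).1) (fun w => (X (Y 0 w) u)%:E)^\- w)%E.
  have E j : ((fun w => (X (Y j w) u)%:E)^\- = fun w => g^\- (Y j w))%E.
    exact: (funeneg_comp g (Y j)).
  rewrite !E; exact: (@ge0_integral_cells s i (g^\-)%E ik (measurable_funeneg mg) (funeneg_ge0 g)).
have mat := measurable_atom (s i).1.
have pf := integrable_pos_fin_num mat iat; have nf := integrable_neg_fin_num mat iat.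
rewrite integralE Ep En [in RHS]integralE -muleBr//; last by rewrite fin_num_adde_defr// fin_numN.
by rewrite fineM// fin_numB pf.
Qed.

Lemma cells_additive (phi : T -> R) j s : P.-integrable setT (EFin \o phi) -> (j < k)%N ->
  \int[P]_(w in cell k cell_of s j.+1) phi w =
  \sum_c \int[P]_(w in cell k cell_of (upd s j c) j) phi w.
Proof.
move=> iphi jk; apply: Rintegral_partition.
- by move=> c; exact: measurable_cells.
- exact: trivIset_cell.
- exact: cell_bigsetU.
- by apply: integrableS iphi => //; exact: measurable_cells.
Qed.

Local Notation dev := (deviation pweight alpha beta).
Local Notation weight := (sgn_weight pweight).

Lemma beta01 c u : 0 <= beta c u <= 1.
Proof. by rewrite /beta; case: (c u).1.2; rewrite ?lexx ler01. Qed.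

(** The left side is positive only if, on the whole atom, coordinate [u] has absolute value at least
    [2 * xi] and coordinate [v] less than [xi]. The sign of coordinate [u] is constant there, so its
    mean over [xi] has absolute value at least 2, against at most 1 for [v], and the two differ by
    at least 1. *)
Lemma alpha_beta_bary c u v : 0 < pweight c ->
  alpha c u - beta c v <= `|bary c u - bary c v|.
Proof.
move=> pc; rewrite /alpha /beta.
case au : (c u).2; last by rewrite sub0r (le_trans _ (normr_ge0 _))// oppr_le0 ler0n.
case bv : (c v).1.2; first by rewrite subrr normr_ge0.
rewrite subr0 -[true%:R]/(1 : R).
have ic z : P.-integrable (atom c) (EFin \o (fun w => X (Y 0 w) z)).
  by apply: integrableS (integrable_XY z k_gt0) => //; exact: measurable_atom.
have icst r : P.-integrable (atom c) (EFin \o cst r).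
  by apply: finite_measure_integrable_cst; exact: measurable_atom.
have mc := measurable_atom c.
have xi0 : xi != 0 by rewrite gt_eqF.
have le_avg z r : (forall w, atom c w -> r <= X (Y 0 w) z) -> r / xi <= bary c z.
  move=> H; rewrite /bary [r / xi]mulrC ler_wpM2l ?invr_ge0 ?(ltW xi_gt0)//.
  by rewrite ler_pdivlMr// -(Rintegral_cst P mc r); apply: le_Rintegral => //; first [exact: icst|exact: ic].
have ge_avg z r : (forall w, atom c w -> X (Y 0 w) z <= r) -> bary c z <= r / xi.
  move=> H; rewrite /bary [r / xi]mulrC ler_wpM2l ?invr_ge0 ?(ltW xi_gt0)//.
  by rewrite ler_pdivrMr// -(Rintegral_cst P mc r); apply: le_Rintegral => //; first [exact: icst|exact: ic].
have v_le : bary c v <= 1.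
  rewrite -(divff xi0); apply: ge_avg => w [Yc].
  by move: bv; rewrite -Yc ffunE /= => /negbT; rewrite -ltNge => /ltW /ler_normlW.
have v_ge : -1 <= bary c v.
  rewrite -(divff xi0) -mulNr; apply: le_avg => w [Yc].
  by move: bv; rewrite -Yc ffunE /= => /negbT; rewrite -ltNge => /ltW; rewrite ler_norml => /andP[].
case su : (c u).1.1.
  have : 2 <= bary c u.
    rewrite -[2](mulfK xi0); apply: le_avg => w [Yc].
    by move: au su; rewrite -Yc ffunE /= => + H; rewrite ger0_norm.
  by have := ler_norm (bary c u - bary c v); lra.
have : bary c u <= - 2.
  rewrite -[- 2](mulfK xi0); apply: ge_avg => w [Yc].
  move: au su; rewrite -Yc ffunE /= => + /negbT; rewrite -ltNge => + H.
  by rewrite ltr0_norm// mulNr lerNr.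
by have := ler_norm (bary c v - bary c u); rewrite distrC; lra.
Qed.

Definition excess w : R := maxf (fun u => \sum_(0 <= i < k) dev (cell_of i w) u).

Lemma measurable_excess : measurable_fun setT excess.
Proof.
apply: measurable_maxf => u.
rewrite (_ : (fun w => _) = fun w => \sum_(i < k) dev (cell_of i w) u); last first.
  by apply/funext => w; rewrite big_mkord.
apply: measurable_sum => i; rewrite /deviation; apply: measurable_funB => //.
rewrite (_ : (fun w => _) = fun w => if xi <= `|X (Y i w) u| then 1 else 0); last first.
  by apply/funext => w; rewrite /beta /cell_of /= ffunE /=; case: ifP.
apply: measurable_fun_ifT => //; apply: measurable_fun_ler => //.
by apply: measurableT_comp => //; exact: measurable_XY.
Qed.

(** The exponential Markov inequality, proved cell by cell: [excess] is constant on each full cell,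
    and [additive_cells_le] assembles the bounds. *)
Lemma excess_tail l r : 0 <= l ->
  expR (l * r) * fine (P [set w | r <= excess w]) <=
  iter k (step weight dev) (fun g => expR (l * maxf g)) (fun=> 0).
Proof.
move=> l0; set B := [set w | _].
have mB : measurable B.
  have : measurable_fun setT (fun w => r <= excess w).
    by apply: measurable_fun_ler => //; exact: measurable_excess.
  by move=> /(_ measurableT [set true]); rewrite setTI; exact.
have iB : P.-integrable setT (EFin \o (\1_B : T -> R)) := integrable_indic P mB.
have mBE D : measurable D -> \int[P]_(w in D) (\1_B w : R) = fine (P (B `&` D)).
  by move=> mD; rewrite /Rintegral integral_indic.
have := @additive_cells_le R _ T k cell_of N
  (fun D => expR (l * r) * \int[P]_(w in D) (\1_B w : R)) weight dev
  (fun g => expR (l * maxf g)) (fun=> ([ffun=> (true, true, true)], true)).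
rewrite mBE// setIT; apply.
- by move=> c; apply: sgn_weight_ge0; exact: pweight_ge0.
- by move=> j s jk; rewrite cells_additive// mulr_sumr.
move=> s; rewrite mBE; last exact: measurable_cells.
rewrite -[\prod_(_ <= _ < _) _]/(fine (\prod_(0 <= i < k) weight (s i))%:E) -prob_cells.
(* If the cell meets [B], the constant value of [excess] on it is at least [r]; otherwise the left
   side is zero. *)
have [->|/set0P[w [/= Bw cw]]] := eqVneq (B `&` cell k cell_of s 0) set0.
  by rewrite measure0 mulr0 mulr_ge0 ?expR_ge0// fine_ge0.
rewrite mulrC; apply: ler_pM; rewrite ?expR_ge0 ?fine_ge0//.
  have mC := measurable_cells s 0; have mBC := measurableI _ _ mB mC.
  by rewrite fine_le ?fin_num_measure// le_measure ?inE.
rewrite ler_expR ler_wpM2l//.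
have E : excess w = maxf (fun u => \sum_(0 <= i < k) dev (s i) u).
  congr maxf; apply/funext => u; apply: eq_big_nat => i /andP[_ ik].
  by rewrite cw.
by rewrite -E.
Qed.

Definition sym_sup w : R :=
  maxf (fun u => \sum_(0 <= i < k) 2 * xi^-1 * (sg i w * X (Y i w) u)).

Lemma integrable_sgX i u : (i < k)%N ->
  P.-integrable setT (fun w => (2 * xi^-1 * (sg i w * X (Y i w) u))%:E).
Proof.
move=> ik.
have -> : (fun w => (2 * xi^-1 * (sg i w * X (Y i w) u))%:E) =
    (fun w => (2 * xi^-1)%:E * (sg i w * X (Y i w) u)%:E)%E.
  by apply/funext => w; rewrite EFinM.
apply: integrableZl => //; apply: le_integrable (integrable_XY u ik) => //.
  apply/measurable_EFinP; apply: measurable_funM; first exact: measurable_sg.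
  exact: measurable_XY.
move=> w _; rewrite !abse_EFin lee_fin normrM /sg.
by case: ifP; rewrite ?normrN normr1 mul1r.
Qed.

Lemma integrable_sgsum u : P.-integrable setT
  (EFin \o (fun w => \sum_(0 <= i < k) 2 * xi^-1 * (sg i w * X (Y i w) u))).
Proof.
rewrite (_ : EFin \o _ = fun w => \sum_(i < k) (2 * xi^-1 * (sg i w * X (Y i w) u))%:E)%E.
  by apply: integrable_sum => // i _; exact: integrable_sgX.
by apply/funext => w; rewrite /= big_mkord sumEFin.
Qed.

Lemma integrable_sym_sup : P.-integrable setT (EFin \o sym_sup).
Proof.
have ms : measurable_fun setT sym_sup.
  by apply: measurable_maxf => u; apply/measurable_EFinP; exact: measurable_int (integrable_sgsum u).
pose f u w := \sum_(0 <= i < k) 2 * xi^-1 * (sg i w * X (Y i w) u).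
have isum : P.-integrable setT (fun w => \sum_(u < N.+1) `|(f u w)%:E|)%E.
  by apply: integrable_sum => // u _; exact: integrable_abse (integrable_sgsum u).
apply: le_integrable isum => //; first exact/measurable_EFinP.
move=> w _ /=; have [u E] := maxf_attained (fun u => f u w).
rewrite -[sym_sup w]/(maxf (fun u => f u w)) E sumEFin lee_fin ger0_norm ?sumr_ge0// (bigD1 u)//= lerDl.
exact: sumr_ge0.
Qed.

(* Jensen on each cell: the conditional mean of [X (Y i) u] given the cell is
   [xi * bary _ u]. *)
Lemma sym_sup_mean :
  iter k (step weight (sgn_shift bary)) maxf (fun=> 0) <= \int[P]_w sym_sup w.
Proof.
apply: (@additive_cells_ge R _ T k cell_of N (fun D => \int[P]_(w in D) sym_sup w)
  weight _ _ (fun=> ([ffun=> (true, true, true)], true))).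
- by move=> c; apply: sgn_weight_ge0; exact: pweight_ge0.
- by move=> j s jk; apply: cells_additive => //; exact: integrable_sym_sup.
(* With [u] maximizing for the averaged shifts of this cell, the supremum dominates coordinate [u]
   at every point of it. *)
move=> s; have [u ->] := maxf_attained (fun u => \sum_(0 <= i < k) sgn_shift bary (s i) u).
have mC := measurable_cells s 0.
pose f w := \sum_(0 <= i < k) 2 * xi^-1 * (sg i w * X (Y i w) u).
have iC phi : P.-integrable setT (EFin \o phi) ->
    P.-integrable (cell k cell_of s 0) (EFin \o phi).
  by move=> H; exact: integrableS H.
apply: (@le_trans _ _ (\int[P]_(w in cell k cell_of s 0) f w)); last first.
  apply: le_Rintegral => //; [exact/iC/integrable_sgsum|exact/iC/integrable_sym_sup|].
  by move=> w _; exact: le_maxf.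
have -> : \int[P]_(w in cell k cell_of s 0) f w = \sum_(0 <= i < k)
    \int[P]_(w in cell k cell_of s 0) (2 * xi^-1 * (sg i w * X (Y i w) u)).
  rewrite /Rintegral big_mkord.
  under eq_integral do rewrite /f big_mkord -sumEFin.
  rewrite integral_sum//; last first.
    move=> i; apply: (iC (fun w => 2 * xi^-1 * (sg i w * X (Y i w) u))).
    exact: integrable_sgX.
  rewrite sum_fine// => i _; apply: integrable_fin_num => //.
  by apply: (iC (fun w => 2 * xi^-1 * (sg i w * X (Y i w) u))); exact: integrable_sgX.
rewrite mulr_sumr le_eqVlt; apply/orP; left; apply/eqP.
apply: eq_big_nat => i /= ik.
pose b : R := if (s i).2 then 1 else -1.
have -> : \int[P]_(w in cell k cell_of s 0) (2 * xi^-1 * (sg i w * X (Y i w) u)) =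
    \int[P]_(w in cell k cell_of s 0) (2 * xi^-1 * b * X (Y i w) u).
  apply: eq_Rintegral => w /set_mem; rewrite cells0E => /(_ i ik)[_ ei].
  by rewrite /sg ei mulrA.
rewrite RintegralZl//; last exact/(iC (fun w => X (Y i w) u))/integrable_XY.
rewrite Rintegral_cells// (others_weightE s ik) /sgn_shift /bary /b.
(* On a null atom both sides vanish, whatever value the division by zero gives to [bary]. *)
have [p0|p0] := eqVneq (pweight (s i).1) 0.
  rewrite p0 mulr0 mul0r /Rintegral null_set_integral ?mulr0//.
  - exact: measurable_atom.
  - by apply: measurable_funTS; apply/measurable_EFinP; exact: measurable_XY.
  - by rewrite -[LHS]fineK ?fin_num_measure ?p0//; [rewrite -/(pweight _) p0|exact: measurable_atom].
by case: (s i).2; field; rewrite p0 gt_eqF.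
Qed.

Lemma excess_deviation (t M : R) : 0 < t -> \int[P]_w sym_sup w <= M ->
  fine (P [set w | M + Num.sqrt k%:R * t <= excess w]) <= expR (- (2 * t ^+ 2)).
Proof.
move=> t0 supM; set B := fine _.
have sk : 0 < Num.sqrt k%:R :> R by rewrite sqrtr_gt0 ltr0n.
have skk : Num.sqrt k%:R ^+ 2 = k%:R :> R by rewrite sqr_sqrtr.
set r := Num.sqrt _ in sk skk B *.
(* This minimizes [k * l ^+ 2 / 8 - l * r * t], with [r ^+ 2 = k]; the minimum is
   [- (2 * t ^+ 2)]. *)
pose l := 4 * t / r.
have l0 : 0 <= l by rewrite divr_ge0 ?mulr_ge0 ?ltW.
have := excess_tail (M + r * t) l0; rewrite -/B => tail.
have := @symmetrized_mgf_le R N _ pweight alpha beta bary pweight_ge0 pweight_sum1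
  beta01 (fun c u v => @alpha_beta_bary c u v) k l (fun=> 0) l0.
move=> /(le_trans tail) H.
have {}H : expR (l * (M + r * t)) * B <= expR (k%:R * (l ^+ 2 / 8)) * expR (l * M).
  apply: (le_trans H); rewrite ler_wpM2l ?expR_ge0// ler_expR ler_wpM2l//.
  exact: le_trans sym_sup_mean supM.
rewrite -(ler_pM2l (expR_gt0 (l * (M + r * t)))); apply: (le_trans H).
rewrite -!expRD ler_expR -skk /l le_eqVlt; apply/orP; left; apply/eqP.
by field; rewrite gt_eqF.
Qed.

End Deviation.

(** * From finitely many vectors to E *)

Section Deterministic.
Import numFieldNormedType.Exports.
Context {R : realType} {n : nat}.
Implicit Types (a : nat -> 'rV[R]_n) (v : 'rV[R]_n).

Lemma dotr_bvec a i v :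
  dotr (bvec a i) v = (Num.sqrt 2)^-1 * (dotr (a (2 * i)%N) v - dotr (a (2 * i).+1) v).
Proof.
rewrite /dotr /bvec -sumrB mulr_sumr; apply: eq_bigr => j _.
by rewrite !mxE -mulrBl mulrA.
Qed.

Lemma dotr_hvec k (e : nat -> R) a v :
  dotr (hvec k e a) v = (Num.sqrt k%:R)^-1 * \sum_(0 <= i < k) e i * dotr (bvec a i) v.
Proof.
rewrite /dotr /hvec big_mkord mulr_sumr.
under eq_bigr => j _ do rewrite !mxE summxE -mulrA mulr_suml mulr_sumr.
rewrite exchange_big/=; apply: eq_bigr => i _.
by rewrite !mulr_sumr; apply: eq_bigr => j _; rewrite !mxE !mulrA.
Qed.

Lemma sum_pairs_le (f : nat -> R) m : (forall i, 0 <= f i) ->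
  \sum_(0 <= i < m./2) (f (2 * i)%N + f (2 * i).+1) <= \sum_(i < m) f i.
Proof.
move=> f0; rewrite -(big_mkord xpredT f).
apply: (@le_trans _ _ (\sum_(0 <= i < m./2.*2) f i)); last first.
  rewrite [leRHS](@big_cat_nat _ _ _ m./2.*2)//= ?lerDl ?sumr_ge0//.
  by rewrite -[leqRHS]odd_double_half leq_addl.
elim: m./2 => [|k IHk]; first by rewrite !big_geq.
by rewrite doubleS !big_nat_recr//= -addrA lerD// -!mul2n.
Qed.

(** Each pair of rows contributes at least the square of [<b_i, v>], hence at least [xi ^+ 2] for
    every block counted by the sum. *)
Lemma normAv_ge m a v (xi : R) : 0 < xi -> (2 <= m)%N ->
  xi / Num.sqrt (m./2)%:R * \sum_(0 <= i < m./2) (xi <= `|dotr (bvec a i) v|)%R%:R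
    <= normAv m a v.
Proof.
move=> xi0 m2; set k := m./2; set s := \sum_(0 <= i < k) _.
have k0 : (0 < k)%N by rewrite /k; lia.
have kR : 0 < k%:R :> R by rewrite ltr0n.
have s0 : 0 <= s by rewrite /s sumr_ge0.
have sk : s <= k%:R.
  rewrite /s -[leRHS]mul1r -{2}[k]subn0 mulr_natr -sumr_const_nat.
  by apply: ler_sum => i _; rewrite lern1 leq_b1.
have lhs0 : 0 <= xi / Num.sqrt k%:R * s.
  by rewrite mulr_ge0 ?divr_ge0 ?sqrtr_ge0 ?(ltW xi0).
rewrite -(ger0_norm lhs0) -sqrtr_sqr /normAv ler_wsqrtr//.
rewrite exprMn expr_div_n sqr_sqrtr ?(ltW kR)//.
(* The count [s] is at most [k], so [s ^+ 2 / k <= s]. *)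
apply: (@le_trans _ _ (xi ^+ 2 * s)).
  rewrite -mulrA ler_wpM2l ?sqr_ge0// mulrC ler_pdivrMr// expr2.
  by rewrite ler_wpM2l.
apply: le_trans (@sum_pairs_le (fun i => dotr (a i) v ^+ 2) m _); last first.
  by move=> i; exact: sqr_ge0.
rewrite /s mulr_sumr; apply: ler_sum => i _.
have H : dotr (bvec a i) v ^+ 2 <= dotr (a (2 * i)%N) v ^+ 2 + dotr (a (2 * i).+1) v ^+ 2.
  rewrite dotr_bvec exprMn exprVn sqr_sqrtr//.
  set x := dotr _ v; set y := dotr _ v.
  by have := sqr_ge0 (x + y); lra.
case: (boolP (xi <= _)) => [xib|_]; last by rewrite mulr0 addr_ge0 ?sqr_ge0.
rewrite mulr1; apply: le_trans H.
by rewrite -[leRHS]real_normK ?num_real// ler_pXn2r ?nnegrE ?(ltW xi0).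
Qed.

Lemma dotr_continuous (x : 'rV[R]_n) : continuous (dotr x).
Proof.
rewrite (_ : dotr x = fun u => \sum_(j < n) x 0 j * u 0 j)//.
apply: (@continuous_big R _ +%R 0 xpredT (@add_continuous _) _ _
  (fun j (u : 'rV[R]_n) => x 0 j * u 0 j)) => j _ v.
exact: (cvgM (cvg_cst _) (@coord_continuous R 1 n 0 j v)).
Qed.

Lemma normAv_continuous m a : continuous (normAv m a).
Proof.
have C : continuous (fun u : 'rV[R]_n => \sum_(i < m) dotr (a i) u ^+ 2).
  apply: (@continuous_big R _ +%R 0 xpredT (@add_continuous _) _ _
    (fun (i : 'I_m) (u : 'rV[R]_n) => dotr (a i) u ^+ 2)) => i _ v.
  exact: (cvgM (@dotr_continuous (a i) v) (@dotr_continuous (a i) v)).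
by move=> v; exact: (continuous_comp (C v) (@sqrt_continuous R _)).
Qed.

(** For every rational vector and every precision a point of [E] within that precision is chosen
    whenever there is one, and [e0] otherwise; these choices are enumerated by [pickle]. *)
Lemma countable_dense (E : set 'rV[R]_n) : E !=set0 ->
  exists2 dn : nat -> 'rV[R]_n, (forall j, E (dn j)) &
    forall v e, E v -> 0 < e -> exists j, forall l, `|v 0 l - dn j 0 l| < e.
Proof.
move=> [e0 Ee0].
pose close (i : 'rV[rat]_n * nat) (x : 'rV[R]_n) :=
  forall l, `|x 0 l - ratr (i.1 0 l)| < i.2.+1%:R^-1.
have /choice[F FE] : forall i, exists x, E x /\ ((exists2 y, E y & close i y) -> close i x).
  move=> i; have [[y Ey cy]|H] := pselect (exists2 y, E y & close i y).
    by exists y.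
  by exists e0.
exists (fun j => F (odflt (0, 0%N) (unpickle j))); first by move=> j; have [] := FE (odflt (0, 0%N) (unpickle j)).
move=> v e Ev e_gt0.
(* Both the given point and the chosen one lie within [M.+1%:R^-1] of the rational vector, so twice
   this precision has to be below [e]. *)
pose M := Num.bound (2 / e).
have Me : 2 * M.+1%:R^-1 < e.
  rewrite -ltr_pdivlMl// mulrC -ltf_pV2 ?posrE ?divr_gt0// ?invr_gt0// invrK invf_div.
  apply: (lt_le_trans (archi_boundP _)); first by rewrite divr_ge0 ?ltW.
  by rewrite ler_nat.
have /choice[q qE] : forall l, exists q : rat, `|v 0 l - ratr q| < M.+1%:R^-1.
  move=> l; have [|q] := @rat_in_itvoo R (v 0 l - M.+1%:R^-1) (v 0 l + M.+1%:R^-1).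
    by rewrite ltrD2l gt0_cp// invr_gt0.
  by rewrite in_itv/= => qv; exists q; rewrite distrC ltr_distl.
pose i : 'rV[rat]_n * nat := (\row_l q l, M).
exists (pickle i) => l; rewrite pickleK/=.
have ci : close i v by move=> l'; rewrite /= mxE.
have [_ /(_ (ex_intro2 _ _ v Ev ci)) /(_ l)] := FE i.
have := ci l; rewrite /= => H1 H2; apply: lt_trans Me.
rewrite mulr_natl mulr2n (le_lt_trans _ (ltrD H1 H2))// [`|F i 0 l - _|]distrC.
by rewrite -[v 0 l - F i 0 l](subrKA (ratr (i.1 0 l))) ler_normD.
Qed.

(** If the norm were below [c] at [v], by continuity it would be so on a ball around [v], which
    contains some [dn j]. *)
Lemma normAv_dense (E : set 'rV[R]_n) (dn : nat -> 'rV[R]_n) m a (c : R) :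
  (forall v e, E v -> 0 < e -> exists j, forall l, `|v 0 l - dn j 0 l| < e) ->
  (forall j, c <= normAv m a (dn j)) -> forall v, E v -> c <= normAv m a v.
Proof.
move=> dense cd v Ev; rewrite leNgt; apply/negP => vc.
have /nbhs_ballP[e /= e0 He] : \forall x \near v, normAv m a x < c.
  by have /cvgr_lt/(_ c vc) := @normAv_continuous m a v.
have [j Hj] := dense v e Ev e0.
have : normAv m a (dn j) < c.
  by apply: He; split => // i l; rewrite ord1; exact: Hj.
by rewrite ltNge cd.
Qed.

End Deterministic.

(** * Application to the random rows and passage to the infimum over [E] *)

Section Assembly.
Context {R : realType} {d : measure_display} {T : measurableType d}
  (P : probability T R) (n m : nat) (E : set 'rV[R]_n)
  (a : nat -> T -> 'rV[R]_n) (eps : nat -> T -> R).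
Local Notation V := (n.-tuple R).
Local Notation k := (m./2).
Hypothesis m_ge2 : (2 <= m)%N.
Hypothesis ma : forall i, (i < m)%N ->
  measurable_fun [set: T] (fun w => rv2tuple (a i w)).
Hypothesis same : forall i, (i < m)%N ->
  same_law P (fun w => rv2tuple (a i w)) (fun w => rv2tuple (a 0%N w)).
Hypothesis rad : forall i, (i < k)%N -> rademacher P (eps i).
Hypothesis indep : indep_family P
    (fun s : ('I_m + 'I_k)%type => match s with
       | inl i => sigma_of (fun w => rv2tuple (a (val i) w))
       | inr j => sigma_of (eps (val j)) end).

Definition supS w : \bar R := supE E (hvec k (fun i => eps i w) (fun i => a i w)).
Hypothesis iS : P.-integrable setT supS.
Let mS : measurable_fun setT supS := measurable_int P iS.

(** The values 1 and -1 together carry the whole mass, so each sign takes another value on a null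
    set only; the union of these sets is still null. *)
Lemma rademacher_null : exists N : set T, [/\ measurable N, P N = 0%E &
  forall w i, ~ N w -> (i < k)%N -> eps i w = sg eps i w].
Proof.
pose F i := if (i < k)%N then [set w | eps i w != 1 /\ eps i w != -1] else set0.
have mF i : measurable (F i).
  rewrite /F; case: ifP => // ik; have [meps _] := rad ik.
  have -> : [set w | eps i w != 1 /\ eps i w != -1] = eps i @^-1` (~` [set 1] `&` ~` [set -1]).
    by apply/seteqP; split => w /= [/eqP ? /eqP ?]; split => //; apply/eqP.
  rewrite -[X in measurable X]setTI; apply: (meps measurableT).
  by apply: measurableI; exact: measurableC.
have PF i : P (F i) = 0%E.
  rewrite /F; case: ifP => [ik|_]; last by rewrite measure0.
  have [meps [P1 PN1]] := rad ik.
  have mpre r : measurable [set w | eps i w = r].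
    by have := meps measurableT [set r] (measurable_set1 r); rewrite setTI.
  have -> : [set w | eps i w != 1 /\ eps i w != -1] =
      ~` ([set w | eps i w = 1] `|` [set w | eps i w = -1]).
    apply/seteqP; split => w /=; first by move=> [/eqP ? /eqP ?] [].
    by move=> H; split; apply/eqP => ?; apply: H; [left|right].
  rewrite probability_setC; last exact: measurableU.
  have -> : P ([set w | eps i w = 1] `|` [set w | eps i w = -1]) =
      (P [set w | eps i w = 1%R] + P [set w | eps i w = (-1)%R])%E.
    apply: measureU => //; apply/seteqP; split => // w [/= -> ].
    by move=> H; have : (1 : R) = -1 := H; lra.
  rewrite P1 PN1 -EFinD (_ : 2^-1 + 2^-1 = 1 :> R); last by field.
  by rewrite -[LHS]/((1 - 1)%R%:E) subrr.
exists (\bigcup_i F i); split.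
- exact: bigcupT_measurable.
- apply/(negligibleP P (bigcupT_measurable _ mF)).
  by apply: negligible_bigcup => i; exact: ((negligibleP P (mF i)).2 (PF i)).
move=> w i Fw ik; rewrite /sg; case: eqP => [//|/eqP e1].
apply/eqP; apply: contra_notT Fw => eN1; exists i => //.
by rewrite /F ik /=; split.
Qed.

Section Sample.
Context (N : nat) (v : 'I_N.+1 -> 'rV[R]_n) (xi : R).
Hypothesis Ev : forall j, E (v j).
Hypothesis xi_gt0 : 0 < xi.

(** The product of [b_i] with [v j], as a function of the pair of rows in a block. *)
Definition projections (y : V * V) (j : 'I_N.+1) : R :=
  (Num.sqrt 2)^-1 * \sum_(l < n) (tnth y.1 l - tnth y.2 l) * v j 0 l.

Lemma projectionsE i w j :
  projections (block a i w) j = dotr (bvec (fun i => a i w) i) (v j).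
Proof.
rewrite /projections /dotr mulr_sumr; apply: eq_bigr => l _.
by rewrite /block /= !tnth_mktuple /bvec !mxE mulrA.
Qed.

Lemma measurable_projections j : measurable_fun setT (fun y => projections y j).
Proof.
apply: measurable_funM => //; apply: measurable_sum => l; apply: measurable_funM => //.
by apply: measurable_funB; apply: (measurableT_comp (measurable_tnth l)).
Qed.

Lemma signed_sum_hvec w j : (forall i, (i < k)%N -> eps i w = sg eps i w) ->
  signed_sum k (block a) eps projections j w =
  Num.sqrt k%:R * dotr (hvec k (fun i => eps i w) (fun i => a i w)) (v j).
Proof.
move=> epsE; rewrite dotr_hvec mulVKf; last first.
  by rewrite gt_eqF// sqrtr_gt0 ltr0n half_gt0.
by apply: eq_big_nat => i /= ik; rewrite projectionsE epsE.
Qed.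

Lemma dotr_le_supS w j :
  ((dotr (hvec k (fun i => eps i w) (fun i => a i w)) (v j))%:E <= supS w)%E.
Proof. by apply: ereal_sup_ubound; exists (v j). Qed.

Let mY i (ik : (i < k)%N) := measurable_block ma ik.
Let k_gt0 : (0 < k)%N. Proof. by rewrite half_gt0. Qed.

Let indepY (D : nat -> set (V * V)) (C : nat -> set R) :
  (forall i, measurable (D i)) -> (forall i, measurable (C i)) ->
  P [set w | forall i, (i < k)%N -> D i (block a i w) /\ C i (eps i w)] =
  (\prod_(i < k) (P (block a 0 @^-1` D i) * P (eps i @^-1` C i)))%E.
Proof. exact: (blocks_indep m_ge2 ma same (fun i ik => (rad ik).1) indep). Qed.

Let sqrtk_gt0 : 0 < Num.sqrt k%:R :> R. Proof. by rewrite sqrtr_gt0 ltr0n. Qed.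

Lemma signed_sum_fin_of_supS j :
  (\int[P]_w (Num.max (signed_sum k (block a) eps projections j w) 0)%:E < +oo)%E.
Proof.
have [B [mB PB epsB]] := rademacher_null.
have mp : measurable_fun setT supS^\+%E by exact: measurable_funepos.
apply: (@le_lt_trans _ _ (\int[P]_w ((Num.sqrt k%:R)%:E * supS^\+ w))%E).
  apply: ae_ge0_le_integral => //.
  - by move=> w _; rewrite lee_fin le_max lexx orbT.
  - apply/measurable_EFinP; apply: measurable_maxr => //.
    exact: (measurable_signed_sum mY measurable_projections rad).
  - by move=> w _; rewrite mule_ge0// lee_fin ltW.
  - exact: measurable_funeM.
  exists B; split => // w /= H; apply: contrapT => Bw; apply: H => _.
  have sk0 : (0 <= (Num.sqrt k%:R)%:E :> \bar R)%E by rewrite lee_fin ltW.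
  rewrite (signed_sum_hvec j (fun i ik => epsB w i Bw ik)) EFin_max ge_max.
  apply/andP; split; last by rewrite mule_ge0.
  rewrite EFinM; apply: lee_wpmul2l => //.
  by rewrite funeposE le_max dotr_le_supS.
rewrite ge0_integralZl_EFin//.
by rewrite lte_mul_pinfty// ?lee_fin ?(ltW sqrtk_gt0)//; exact: integral_funepos_lt_pinfty.
Qed.

(** Almost surely [sym_sup] is [2 / xi * sqrt k] times the largest [<h, v j>]; the factor [sqrt k]
    undoes the normalization of [h]. *)
Lemma sym_sup_le_supS : \int[P]_w sym_sup k (block a) eps projections xi w <=
  2 * xi^-1 * Num.sqrt k%:R * fine (\int[P]_w supS w)%E.
Proof.
have [B [mB PB epsB]] := rademacher_null.
have isup := integrable_sym_sup xi k_gt0 mY measurable_projections rad indepY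
  signed_sum_fin_of_supS.
have c0 : 0 <= 2 * xi^-1 * Num.sqrt k%:R.
  by rewrite !mulr_ge0 ?invr_ge0 ?(ltW xi_gt0) ?(ltW sqrtk_gt0).
set c := _ * Num.sqrt _ in c0 *.
have iW : (\int[P]_w supS w)%E \is a fin_num by exact: integrable_fin_num.
have icS : P.-integrable setT (fun w => c%:E * supS w)%E by exact: integrableZl.
rewrite -[leRHS]/(fine c%:E * _) -fineM// -integralZl//.
rewrite /Rintegral fine_le//; [exact: integrable_fin_num|exact: integrable_fin_num|].
rewrite (negligible_integral mB measurableT isup PB).
rewrite (negligible_integral mB measurableT icS PB).
have mTB : measurable (setT `\` B) by exact: measurableD.
apply: le_integral; [by [] | exact: integrableS isup | exact: integrableS icS |].
move=> w /set_mem[_ Bw]; rewrite /= /sym_sup.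
have [j ->] := maxf_attained (fun u => \sum_(0 <= i < k) 2 * xi^-1 *
  (sg eps i w * projections (block a i w) u)).
rewrite -mulr_sumr -/(signed_sum k (block a) eps projections j w).
rewrite (signed_sum_hvec j (fun i ik => epsB w i Bw ik)) mulrA EFinM.
by rewrite lee_wpmul2l ?lee_fin// dotr_le_supS.
Qed.

Lemma measurable_normAv u : measurable_fun setT (fun w => normAv m (fun i => a i w) u).
Proof.
rewrite /normAv; apply: (measurableT_comp (continuous_measurable_fun (@sqrt_continuous R))).
apply: measurable_sum => i; apply: measurable_funX; rewrite /dotr.
apply: measurable_sum => l; apply: measurable_funM => //.
have := (measurable_fun_tnthP _).1 (ma (ltn_ord i)) l.
by congr measurable_fun; apply/funext => w; rewrite /= tnth_mktuple.
Qed.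

Lemma measurable_ball_event j (r : R) :
  measurable [set w | r <= `|dotr (bvec (fun i => a i w) 0) (v j)|].
Proof.
have mf := measurableT_comp (measurable_projections j) (mY k_gt0).
have : measurable_fun setT (fun w => r <= `|projections (block a 0 w) j|).
  by apply: measurable_fun_ler => //; exact: measurableT_comp mf.
move=> /(_ measurableT [set true]); rewrite setTI.
rewrite (_ : [set w | _] = (fun w => r <= `|projections (block a 0 w) j|) @^-1` [set true]).
  by apply.
by apply/seteqP; split => w /=; rewrite projectionsE.
Qed.

Lemma sample_bound (t Q c : R) : 0 < t -> 0 <= Q ->
  (forall u, E u -> (Q%:E <= P [set w | (2 * xi <= `|dotr (bvec (fun i => a i w) 0) u|)%R])%E) ->
  c = xi * Num.sqrt ((m%:R - 1) / 2) * Q - xi * t - 2 * fine (\int[P]_w supS w)%E ->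
  ((1 - expR (- (2 * t ^+ 2)))%:E <=
    P [set w | forall j, (c <= normAv m (fun i => a i w) (v j))%R])%E.
Proof.
move=> t0 Q0 QE cE; set G := [set w | forall j, _].
have mG : measurable G.
  have -> : G = \bigcap_(j in [set: 'I_N.+1]) [set w | c <= normAv m (fun i => a i w) (v j)].
    by apply/seteqP; split => [w H j _|w H j]; exact: H.
  apply: fin_bigcap_measurable => // j _.
  have : measurable_fun setT (fun w => c <= normAv m (fun i => a i w) (v j)).
    by apply: measurable_fun_ler => //; exact: measurable_normAv.
  by move=> /(_ measurableT [set true]); rewrite setTI; exact.
have := excess_deviation k_gt0 xi_gt0 mY measurable_projections rad indepY
  signed_sum_fin_of_supS t0 sym_sup_le_supS.
set M := _ * fine _; set B := [set w | M + _ <= _] => PB.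
have mB : measurable B.
  have : measurable_fun setT (fun w => M + Num.sqrt k%:R * t <=
      excess P k (block a) eps projections xi w).
    apply: measurable_fun_ler => //.
    exact: (measurable_excess P eps xi mY measurable_projections).
  by move=> /(_ measurableT [set true]); rewrite setTI; exact.
(* Outside [B] every coordinate of the deviation is below [M + sqrt k * t], which bounds the count
   [s] from below. *)
apply: (@le_trans _ _ (P (~` B))).
  rewrite probability_setC// -[P B]fineK ?fin_num_measure//.
  by rewrite -[X in (_ <= X)%E]/((1 - fine (P B))%:E) lee_fin lerB.
rewrite le_measure ?inE//; first exact: measurableC.
move=> w /negP; rewrite -ltNge => exw j.
have := le_lt_trans (le_maxf _ j) exw; rewrite /deviation sumrB.
rewrite sumr_const_nat subn0 (sum_alpha P xi k_gt0 mY measurable_projections).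
set q := fine _; set s := \sum_(0 <= i < k) _ => H.
have qQ : Q <= q.
  have setE : [set w | 2 * xi <= `|projections (block a 0 w) j|] =
      [set w | 2 * xi <= `|dotr (bvec (fun i => a i w) 0) (v j)|].
    by apply/seteqP; split => w' /=; rewrite projectionsE.
  rewrite -lee_fin /q setE fineK ?fin_num_measure//; first exact: QE.
  exact: measurable_ball_event.
apply: le_trans (@normAv_ge _ _ m (fun i => a i w) (v j) xi xi_gt0 m_ge2).
rewrite (_ : \sum_(0 <= i < k) _ = s); last first.
  by apply: eq_bigr => i _; rewrite /beta /cell_of /= ffunE /= projectionsE.
have skk : Num.sqrt k%:R ^+ 2 = k%:R :> R by rewrite sqr_sqrtr.
(* The integer part of [m / 2] is at least [(m - 1) / 2]. *)
have mk : Num.sqrt ((m%:R - 1) / 2) <= Num.sqrt k%:R :> R.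
  rewrite ler_wsqrtr// ler_pdivrMr// lerBlDr -natrM natr1 ler_nat; lia.
have r0 := sqrtk_gt0.
move: H; rewrite -[q *+ k]mulr_natr /M cE; set W := fine _.
set r := Num.sqrt k%:R in skk r0 mk *; set z := Num.sqrt _ in mk *.
rewrite -skk => H.
(* The added term is [xi / r] times the slack in [H], hence nonnegative. *)
have -> : xi / r * s = xi * r * q - xi * t - 2 * W +
    xi / r * (2 * xi^-1 * r * W + r * t - (q * r ^+ 2 - s)).
  by field; rewrite !gt_eqF.
have zq : z * Q <= r * q by rewrite ler_pM ?sqrtr_ge0.
have ? : 0 <= xi / r * (2 * xi^-1 * r * W + r * t - (q * r ^+ 2 - s)).
  by rewrite mulr_ge0 ?divr_ge0 ?subr_ge0 ?(ltW xi_gt0) ?(ltW r0) ?(ltW H).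
rewrite -!mulrA; have := ler_wpM2l (ltW xi_gt0) zq; lra.
Qed.

End Sample.

(** The events for the first [N + 1] points of a countable dense subset decrease with [N] and all
    satisfy the same lower bound, so continuity from above passes it to their intersection. *)
Lemma infimum_bound (t xi Q c : R) : 0 < t -> 0 < xi -> 0 <= Q -> E !=set0 ->
  (forall u, E u -> (Q%:E <= P [set w | (2 * xi <= `|dotr (bvec (fun i => a i w) 0) u|)%R])%E) ->
  c = xi * Num.sqrt ((m%:R - 1) / 2) * Q - xi * t - 2 * fine (\int[P]_w supS w)%E ->
  exists G : set T, [/\ measurable G, ((1 - expR (- (2 * t ^+ 2)))%:E <= P G)%E &
    forall w, G w -> forall u, E u -> c <= normAv m (fun i => a i w) u].
Proof.
move=> t0 xi0 Q0 E0 QE cE.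
have [dn Edn dense] := countable_dense E0.
pose F N : set T := [set w | forall j : 'I_N.+1, c <= normAv m (fun i => a i w) (dn j)].
have mF N : measurable (F N).
  have -> : F N = \bigcap_(j in [set: 'I_N.+1]) [set w | c <= normAv m (fun i => a i w) (dn j)].
    by apply/seteqP; split => [w H j _|w H j]; exact: H.
  apply: fin_bigcap_measurable => // j _.
  have : measurable_fun setT (fun w => c <= normAv m (fun i => a i w) (dn j)).
    by apply: measurable_fun_ler => //; exact: measurable_normAv.
  by move=> /(_ measurableT [set true]); rewrite setTI; exact.
have mG : measurable (\bigcap_N F N) by exact: bigcapT_measurable.
exists (\bigcap_N F N); split => //.
  have ndF : nonincreasing_seq F.
    move=> i j ij; apply/subsetPset => w H l.
    have ij' : (i.+1 <= j.+1)%N by rewrite ltnS.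
    exact: (H (widen_ord ij' l)).
  have PF0 : (P (F 0%N) < +oo)%E by rewrite (le_lt_trans (probability_le1 _ _)) ?ltry.
  have cvgF := nonincreasing_cvg_mu PF0 mF mG ndF.
  rewrite -(cvg_lim _ cvgF)//; apply: lime_ge; first by apply/cvg_ex; exists (P (\bigcap_N F N)).
  apply: nearW => N /=; by apply: (sample_bound _ xi0 t0 Q0 QE cE) => j; exact: Edn.
move=> w Gw; apply: (normAv_dense dense) => j.
exact: (Gw j Logic.I ord_max).
Qed.

End Assembly.

Unset Implicit Arguments.
Set Strict Implicit.
Set Printing Implicit Defensive.

Theorem theorem4 (R : realType) (d : measure_display) (T : measurableType d)
  (P : probability T R) (n m : nat) (E : set 'rV[R]_n)
  (a : nat -> T -> 'rV[R]_n) (eps : nat -> T -> R) :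
  (2 <= m)%N ->
  (forall i, (i < m)%N -> measurable_fun [set: T] (fun w => rv2tuple (a i w))) ->
  (forall i, (i < m)%N ->
     same_law P (fun w => rv2tuple (a i w)) (fun w => rv2tuple (a 0%N w))) ->
  (forall k, (k < m./2)%N -> rademacher P (eps k)) ->
  indep_family P
    (fun s : ('I_m + 'I_(m./2))%type => match s with
       | inl i => sigma_of (fun w => rv2tuple (a (val i) w))
       | inr k => sigma_of (eps (val k)) end) ->
  measurable_fun [set: T]
    (fun w => supE E (hvec m./2 (fun k => eps k w) (fun i => a i w))) ->
  (\int[P]_w (fun w => supE E (hvec m./2 (fun k => eps k w) (fun i => a i w)))^\- w
     < +oo)%E ->
  forall t xi : R, 0 < t -> 0 < xi ->
  exists G : set T, [/\ measurable G,
    (P G >= (1 - expR (- (2 * t ^+ 2)))%:E)%E &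
    forall w, G w ->
      (ereal_inf [set (normAv m (fun i => a i w) v)%:E | v in E] >=
        (xi * Num.sqrt ((m%:R - 1) / 2))%:E
          * Qxi P E (fun w => bvec (fun i => a i w) 0) (2 * xi)
        - (xi * t)%:E
        - 2%:E * Wk P E (fun w => hvec m./2 (fun k => eps k w) (fun i => a i w)))%E].
Proof.
move=> m2 ma same rad indep mS negS t xi t0 xi0.
pose b w := bvec (fun i => a i w) 0.
(* For empty [E] the infimum on the left is [+oo]. *)
have [->|/set0P E0] := eqVneq E set0.
  exists setT; split => //; first by rewrite probability_setT lee_fin gerBl expR_ge0.
  by move=> w _; rewrite image_set0 ereal_inf0 leey.
have Qfin : Qxi P E b (2 * xi) \is a fin_num.
  rewrite ge0_fin_numE; last by apply: le_ereal_inf_tmp => _ [u _ <-]; exact: measure_ge0.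
  have [u Eu] := E0.
  apply: (@le_lt_trans _ _ (P [set w | (2 * xi <= `|dotr (b w) u|)%R])).
    by apply: ereal_inf_lbound; exists u.
  apply: (@le_lt_trans _ _ 1%E); last exact: ltry.
  apply: probability_le1.
  exact: (measurable_ball_event m2 ma (fun=> u) ord0 (2 * xi)).
have Qge0 : 0 <= fine (Qxi P E b (2 * xi)).
  by rewrite fine_ge0//; apply: le_ereal_inf_tmp => _ [u _ <-]; exact: measure_ge0.
pose S := supS m E a eps.
rewrite -/b -[fun w => hvec _ _ _]/(fun w => hvec m./2 (fun k => eps k w) (fun i => a i w)).
have WE : Wk P E (fun w => hvec m./2 (fun k => eps k w) (fun i => a i w)) =
  (\int[P]_w S w)%E by [].
rewrite WE.
have nfin : (\int[P]_w S^\- w)%E \is a fin_num.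
  by rewrite ge0_fin_numE// integral_ge0.
(* The negative part being integrable, an infinite positive part makes W equal to [+oo] and the
   right side [-oo]; otherwise the supremum is integrable. *)
have [posS|posS] := eqVneq (\int[P]_w S^\+ w)%E +oo%E.
  exists setT; split => //; first by rewrite probability_setT lee_fin gerBl expR_ge0.
  move=> w _; rewrite (_ : (\int[P]_w S w)%E = +oo%E); last first.
    by rewrite integralE posS -(fineK nfin) addye.
  by rewrite gt0_muley ?lte_fin// addeNy leNye.
have iS : P.-integrable setT S.
  apply/integrableP; split => //.
  under eq_integral do rewrite -/((abse \o S) _) fune_abse.
  rewrite ge0_integralD//; last 2 first.
  - exact: measurable_funepos.
  - exact: measurable_funeneg.
  by apply: lte_add_pinfty; [rewrite ltey|exact: negS].
have [] := @infimum_bound R d T P n m E a eps m2 ma same rad indep iS t xi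
  (fine (Qxi P E b (2 * xi))) _ t0 xi0 Qge0 E0 _ (erefl _).
  by move=> u Eu; rewrite fineK//; apply: ereal_inf_lbound; exists u.
move=> G [mG PG HG]; exists G; split => // w Gw.
apply: le_ereal_inf_tmp => _ [u Eu <-].
rewrite -(fineK Qfin) -(fineK (integrable_fin_num measurableT iS)).
by rewrite -!EFinM -!EFinB lee_fin; exact: HG.
Qed.
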